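(* (1) Let $\{V_i\}_{i\in I}$ be a collection of $k$-vector spaces and for each $i$ let $W_i\subseteq V_i^*$ be a subspace separating the points of $V_i$. Then the $k$-algebra $D=\bigoplus_{i\in I}M_{W_i}(V_i)$ has local units and is absolutely semisimple. (2) Every absolutely semisimple $k$-algebra with local units is isomorphic to an algebra of the form in (1).
   Context: All algebras are associative $k$-algebras ($k$ a field), not necessarily unital. A $D$-module $V$ is unital if $V=DV$; simple if $DV\neq 0$ and $\{0\},V$ are its only submodules; absolutely simple if $K\otimes_k V$ is a simple $K\otimes_k D$-module for every field extension $k\subseteq K$; absolutely semisimple if it is a direct sum of absolutely simple modules. An algebra is absolutely semisimple if every unital module over it is absolutely semisimple. $D$ has local units if for every finite subset $\{x_1,\dots,x_n\}\subseteq D$ there is an idempotent $e\in D$ with $ex_i=x_i=x_ie$. For a vector space $V$ and subspace $W\subseteq V^*$ separating points of $V$, $M_W(V)$ denotes the algebra (under composition) of $W$-finite rank operators, i.e. the linear span of the operators $T_{v,\omega}:w\mapsto\omega(w)v$ with $v\in V$, $\omega\in W$. *)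

(* Defs.v *)
From HB Require Import structures.
From mathcomp Require Import all_boot all_order all_algebra.
From Stdlib Require List.

Set Implicit Arguments.
Unset Strict Implicit.
Unset Printing Implicit Defensive.

Import GRing.Theory.
Local Open Scope ring_scope.

Section Defs.
Variable k : fieldType.

Record nualg := NUAlg {
  nua_carrier :> lmodType k;
  nua_mul : nua_carrier -> nua_carrier -> nua_carrier;
  nua_mulA : forall x y z, nua_mul x (nua_mul y z) = nua_mul (nua_mul x y) z;
  nua_mulDl : forall x y z, nua_mul (x + y) z = nua_mul x z + nua_mul y z;
  nua_mulDr : forall x y z, nua_mul x (y + z) = nua_mul x y + nua_mul x z;
  nua_mulZl : forall (a : k) x y, nua_mul (a *: x) y = a *: nua_mul x y;
  nua_mulZr : forall (a : k) x y, nua_mul x (a *: y) = a *: nua_mul x y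
}.

Record numod (D : nualg) := NUMod {
  num_carrier :> lmodType k;
  num_act : D -> num_carrier -> num_carrier;
  num_actDl : forall (d e : D) m, num_act (d + e) m = num_act d m + num_act e m;
  num_actDr : forall (d : D) m n, num_act d (m + n) = num_act d m + num_act d n;
  num_actZl : forall (a : k) (d : D) m, num_act (a *: d) m = a *: num_act d m;
  num_actZr : forall (a : k) (d : D) m, num_act d (a *: m) = a *: num_act d m;
  num_actA : forall (d e : D) m, num_act (nua_mul d e) m = num_act d (num_act e m)
}.

(** V is unital: V = DV (the k-span of all d v; scalars are absorbed into d). *)
Definition unital_mod (D : nualg) (M : numod D) : Prop :=
  forall m : M, exists s : seq (D * M), m = \sum_(p <- s) num_act p.1 p.2.

Definition mod_hom (D : nualg) (M N : numod D) (f : M -> N) : Prop :=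
  (forall (a : k) (x y : M), f (a *: x + y) = a *: f x + f y) /\
  (forall (d : D) (x : M), f (num_act d x) = num_act d (f x)).

Definition has_local_units (D : nualg) : Prop :=
  forall xs : seq D, exists e : D,
    nua_mul e e = e /\
    forall x, List.In x xs -> nua_mul e x = x /\ nua_mul x e = x.

End Defs.

Section Extension.
Variables (k K : fieldType) (iota : {rmorphism k -> K}).

Definition Klinear (T U : lmodType K) (g : T -> U) : Prop :=
  forall (a : K) x y, g (a *: x + y) = a *: g x + g y.

Definition restr_linear (V : lmodType k) (U : lmodType K) (f : V -> U) : Prop :=
  forall (a : k) x y, f (a *: x + y) = iota a *: f x + f y.

(** (T, j) is the scalar extension K (x)_k V, characterised by its universal
    property: every k-linear map V -> U into a K-space U extends uniquely to a
    K-linear map T -> U  (j v corresponds to 1 (x) v). *)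
Definition scalar_ext (V : lmodType k) (T : lmodType K) (j : V -> T) : Prop :=
  restr_linear j /\
  forall (U : lmodType K) (f : V -> U), restr_linear f ->
    (exists g : T -> U, Klinear g /\ forall v, g (j v) = f v) /\
    (forall g1 g2 : T -> U, Klinear g1 -> Klinear g2 ->
        (forall v, g1 (j v) = g2 (j v)) -> forall t, g1 t = g2 t).
End Extension.

Section Simple.
Variable k : fieldType.

(** Simplicity of the K (x)_k D - module T, where d in D acts by the K-linear
    operator rho d (so a (x) d acts by a * rho d).  Its submodules are exactly
    the K-subspaces stable under every rho d, and (K (x) D) T <> 0 iff some
    rho d t <> 0. *)
Definition simple_ops (K : fieldType) (D : nualg k) (T : lmodType K)
    (rho : D -> T -> T) : Prop :=
  (exists (d : D) (t : T), rho d t <> 0) /\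
  forall S : T -> Prop,
    S 0 -> (forall x y, S x -> S y -> S (x + y)) ->
    (forall (a : K) x, S x -> S (a *: x)) ->
    (forall d x, S x -> S (rho d x)) ->
    (forall x, S x -> x = 0) \/ (forall x, S x).

Definition abs_simple (D : nualg k) (M : numod D) : Prop :=
  forall (K : fieldType) (iota : {rmorphism k -> K}) (T : lmodType K) (j : M -> T),
    scalar_ext iota j ->
    forall rho : D -> T -> T,
      (forall d, Klinear (rho d)) ->
      (forall d m, rho d (j m) = j (num_act d m)) ->
      simple_ops rho.

Definition abs_semisimple_mod (D : nualg k) (M : numod D) : Prop :=
  exists (J : Type) (N : J -> numod D) (inj : forall j, N j -> M),
    (forall j, abs_simple (N j)) /\
    (forall j, mod_hom (inj j)) /\
    (forall s : seq {j : J & N j}, List.NoDup (map (@projT1 _ _) s) ->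
        \sum_(p <- s) inj (projT1 p) (projT2 p) = 0 ->
        forall p, List.In p s -> projT2 p = 0) /\
    (forall m : M, exists s : seq {j : J & N j},
        m = \sum_(p <- s) inj (projT1 p) (projT2 p)).

Definition abs_semisimple_alg (D : nualg k) : Prop :=
  forall M : numod D, unital_mod M -> abs_semisimple_mod M.

Definition separating_dual_subspace (V : lmodType k) (W : (V -> k) -> Prop) : Prop :=
  (forall w, W w -> forall (a : k) x y, w (a *: x + y) = a * w x + w y) /\
  W (fun _ => 0) /\
  (forall w1 w2, W w1 -> W w2 -> W (fun x => w1 x + w2 x)) /\
  (forall (a : k) w, W w -> W (fun x => a * w x)) /\
  (forall v v' : V, v <> v' -> exists w, W w /\ w v <> w v').

Definition T_op (V : lmodType k) (v : V) (w : V -> k) : V -> V :=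
  fun x => w x *: v.

Definition in_MW (V : lmodType k) (W : (V -> k) -> Prop) (f : V -> V) : Prop :=
  exists s : seq (V * (V -> k)),
    (forall p, List.In p s -> W p.2) /\
    forall x, f x = \sum_(p <- s) T_op p.1 p.2 x.

(** rho is an algebra isomorphism from D onto (+)_{i in I} M_{W_i}(V_i), the
    latter viewed as the subalgebra of finitely supported families of the
    product algebra prod_i End_k(V_i) (composition as multiplication):
    rho is an injective algebra homomorphism D -> prod_i End(V_i) whose image
    consists of finitely supported families with i-th component in
    M_{W_i}(V_i), and contains every such family supported at one index. *)
Definition dsum_MW_iso (D : nualg k) (I : Type) (V : I -> lmodType k)
    (W : forall i, (V i -> k) -> Prop) (rho : forall i, D -> V i -> V i) : Prop :=
  (forall i (d e : D) v, rho i (d + e) v = rho i d v + rho i e v) /\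
  (forall i (a : k) (d : D) v, rho i (a *: d) v = a *: rho i d v) /\
  (forall i (d e : D) v, rho i (nua_mul d e) v = rho i d (rho i e v)) /\
  (forall d : D, (forall i v, rho i d v = 0) -> d = 0) /\
  (forall d : D, exists s : seq I, forall i, ~ List.In i s -> forall v, rho i d v = 0) /\
  (forall i (d : D), in_MW (W i) (rho i d)) /\
  (forall i (f : V i -> V i), in_MW (W i) f ->
     exists d : D, (forall v, rho i d v = f v) /\
                   forall j, j <> i -> forall v, rho j d v = 0).

End Simple.

(* Main.v *)
Require Import Defs.
From HB Require Import structures.
From mathcomp Require Import all_boot all_order all_algebra.
From mathcomp Require Import boolp classical_sets.

(** (1) Given e idempotent, v in V_i and w in W_i with w (v - e v) = 1, adding
    to e the rank one operator x |-> (w - w e)(x) (v - e v) yields a larger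
    idempotent fixing v and w; iterating gives local units.  The D-module V_i
    is absolutely simple: a nonzero t in K (x) V_i is fixed by some local unit,
    a sum of operators T_{u,w}, hence some T_{u,w} sends t to a nonzero multiple
    of u, and by varying u the submodule generated by t is everything.  Fixing
    e_i = T_{v_i,w_i} with w_i (v_i) = 1, a unital module M is the direct sum of
    the copies {T_{v,w_i} b | v in V_i} of V_i, where b runs over a basis of
    the vector space e_i M.

    (2) If N is absolutely simple then End_D(N) = k: otherwise the bicommutant K
    of a nonscalar endomorphism alpha is a field and K (x) N -> N has a nonzero
    proper kernel.  Write D as a direct sum of absolutely simple left ideals N_j
    and let V_i represent their isomorphism classes.  For x in V_i, the map
    n |-> n x lies in Hom_D(N_j, V_i), which has dimension at most 1; so every
    n in N_j acts on V_i with rank at most 1, as x |-> lambda_j(x) phi(n) when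
    phi : N_j -> V_i is an isomorphism, and as 0 otherwise. *)

Set Implicit Arguments.
Unset Strict Implicit.
Unset Printing Implicit Defensive.

Import GRing.Theory.
Local Open Scope ring_scope.

(** * Bases, functionals and scalar extension *)

(** Tukey's lemma, from Zorn: a finite list drawn from the union of a chain already lies in one
    member of the chain. It yields both bases and hyperplanes below. *)
Lemma maximal_of_finite_character (T : eqType) (q : seq T -> Prop) :
  (forall s t, {subset s <= t} -> q t -> q s) -> q [::] ->
  exists B : T -> Prop,
    (forall s, (forall x, x \in s -> B x) -> q s) /\
    (forall x, (forall s, (forall y, y \in s -> B y \/ y = x) -> q s) -> B x).
Proof.
move=> q_sub q0.
pose P : set (set T) := fun B => forall s, (forall x, x \in s -> B x) -> q s.
have [F FP Ftot|B [PB Bmax]] := @Zorn_bigcup T P.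
  move=> s sF.
  have [->//|[X FX sX]] : s = [::] \/ exists2 X, F X & forall x, x \in s -> X x.
    elim: s sF => [|x s IHs] sF; first by left.
    right; have [X FX Xx] := sF x (mem_head _ _).
    have /IHs[s0|[Y FY sY]] : forall y, y \in s -> (\bigcup_(X0 in F) X0)%classic y.
    - by move=> y ys; apply: sF; rewrite inE ys orbT.
    - by exists X => // y; rewrite s0 inE => /eqP->.
    have [XY|YX] := Ftot X Y FX FY.
      by exists Y => // y; rewrite inE => /predU1P[->|/sY//]; exact: XY.
    by exists X => // y; rewrite inE => /predU1P[->//|/sY]; exact: YX.
  exact: FP FX _ sX.
exists B; split => // x xB; apply: contrapT => nBx.
have : P (fun y => B y \/ y = x) by [].
apply: Bmax; split; first by move=> y By; left.
by move=> /(_ x) /=; apply: contra_not nBx; apply; right.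
Qed.

Section LinearAlgebra.
Variables (k : fieldType) (V : lmodType k).

Definition subspace (P : V -> Prop) : Prop :=
  P 0 /\ forall (a : k) x y, P x -> P y -> P (a *: x + y).

(** Coefficients are indexed by vectors and duplicates are removed, so the property depends only on
    the set of entries of [s]. *)
Definition lin_indep (s : seq V) : Prop :=
  forall c : V -> k, \sum_(b <- undup s) c b *: b = 0 ->
  forall b, b \in s -> c b = 0.

(** [B] is maximal among the subsets of [P] whose finite parts are independent. A vector of [P]
    outside [B] then enters a dependence relation, which can be solved for it. *)
Lemma subspace_basis (P : V -> Prop) : subspace P ->
  exists B : V -> Prop,
    (forall b, B b -> P b) /\
    (forall s, (forall b, b \in s -> B b) -> lin_indep s) /\
    (forall x, P x -> exists s : seq (k * V),
       (forall p, p \in s -> B p.2) /\ x = \sum_(p <- s) p.1 *: p.2).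
Proof.
move=> subP.
pose q s := lin_indep s /\ forall b, b \in s -> P b.
have q_sub s t : {subset s <= t} -> q t -> q s.
  move=> st [indt Pt]; split=> [c c0 b bs|b /st/Pt//].
  (* A relation on [s] is extended by zero to a relation on [t]. *)
  pose c' x := if x \in s then c x else 0.
  suff : c' b = 0 by rewrite /c' bs.
  apply: indt (st _ bs); rewrite -[RHS]c0 /c' (bigID (mem s)) /=.
  rewrite [X in _ + X]big1 => [|x /negPf->]; last by rewrite scale0r.
  rewrite addr0 -big_filter; under [LHS]eq_big_seq => x.
    by rewrite mem_filter => /andP[->]; over.
  apply: perm_big; apply: uniq_perm; rewrite ?filter_uniq ?undup_uniq //.
  move=> x; rewrite mem_filter !mem_undup; case: (boolP (x \in s)) => //=.
  by move=> /st->.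
have q0 : q [::] by split.
have [B [Bq Bmax]] := maximal_of_finite_character q_sub q0.
have BP b : B b -> P b.
  move=> Bb; apply: (Bq [:: b] _).2; last exact: mem_head.
  by move=> x; rewrite inE => /eqP->.
exists B; split=> //; split=> [s /Bq[]//|x Px].
have [Bx|nBx] := pselect (B x).
  exists [:: (1, x)]; split; first by move=> p; rewrite inE => /eqP->.
  by rewrite big_seq1 /= scale1r.
have /existsNP[s /not_implyP[sB nqs]] :
    ~ forall s, (forall y, y \in s -> B y \/ y = x) -> q s.
  by move=> /Bmax.
have sP b : b \in s -> P b by move=> /sB[/BP|->].
have /existsNP[c /not_implyP[c0 /existsNP[b /not_implyP[bs cb]]]] : ~ lin_indep s.
  by move=> inds; apply: nqs.
pose s' := rem x (undup s).
have s'B y : y \in s' -> B y.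
  rewrite mem_rem_uniq ?undup_uniq// !inE mem_undup => /andP[yx /sB[//|yxE]].
  by rewrite yxE eqxx in yx.
have us' : uniq s' by rewrite rem_uniq ?undup_uniq.
have xs : x \in s.
  apply: contrapT => /negP xs; apply: cb.
  have [inds _] : q s; last exact: inds c0 _ bs.
  apply: Bq => y ys; have [//|yx] := sB y ys.
  by rewrite -yx ys in xs.
have sumE : \sum_(b <- undup s) c b *: b = c x *: x + \sum_(b <- s') c b *: b.
  by rewrite (big_rem x) ?mem_undup.
(* With [c x = 0] the relation would be a nontrivial one among elements of [B]. *)
have cx : c x != 0.
  apply/eqP => cx; move: c0; rewrite sumE cx scale0r add0r => s'0.
  have [bx|bx] := eqVneq b x; first by apply: cb; rewrite bx.
  apply: cb; have [inds' _] : q s' by exact: Bq.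
  apply: inds'; first by rewrite undup_id.
  by rewrite mem_rem_uniq ?undup_uniq// !inE mem_undup bx.
exists [seq (- (c x)^-1 * c b, b) | b <- s']; split.
  by move=> p /mapP[y ys ->]; exact: s'B.
rewrite big_map /=; under eq_bigr do rewrite -scalerA.
rewrite -scaler_sumr scaleNr -scalerN; move: c0; rewrite sumE => /eqP.
by rewrite addr_eq0 => /eqP<-; rewrite scalerA mulVf ?scale1r.
Qed.

Lemma functional_nonzero (v : V) : v <> 0 ->
  exists2 mu : V -> k, (forall a x y, mu (a *: x + y) = a * mu x + mu y) & mu v = 1.
Proof.
move=> v0; pose spans (B : V -> Prop) x := exists s : seq (k * V),
  (forall p, p \in s -> B p.2) /\ x = \sum_(p <- s) p.1 *: p.2.
have spanD B : subspace (spans B).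
  split; first by exists [::]; rewrite big_nil.
  move=> a _ _ [s [sB ->]] [t [tB ->]]; exists ([seq (a * p.1, p.2) | p <- s] ++ t).
  split; first by move=> p; rewrite mem_cat => /orP[/mapP[r /sB + ->]//|/tB].
  rewrite big_cat big_map scaler_sumr; congr (_ + _).
  by apply: eq_bigr => p _; rewrite scalerA.
(* A set B maximal among those whose span misses v spans a hyperplane complementary to v. *)
pose q (s : seq V) := ~ spans (fun b => b \in s) v.
have q_sub s t : {subset s <= t} -> q t -> q s.
  by move=> st qt [r [rs vE]]; apply: qt; exists r; split => // p /rs/st.
have q0 : q [::].
  by case=> -[[_]|p s [/(_ p (mem_head _ _))]//]; rewrite big_nil.
have [B [Bq Bmax]] := maximal_of_finite_character q_sub q0.
have nBv : ~ spans B v.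
  move=> [s [sB vE]]; apply: (Bq [seq p.2 | p <- s]).
    by move=> x /mapP[p /sB + ->].
  by exists s; split => // p ps; apply: map_f.
(* Modulo the hyperplane, [x] is a unique multiple of [v]; the functional reads off that
   coefficient. *)
have decomp x : exists c, spans B (x - c *: v).
  have [Bx|nBx] := pselect (B x).
    exists 0; exists [:: (1, x)]; split; first by move=> p; rewrite inE => /eqP->.
    by rewrite big_seq1 scale0r subr0 scale1r.
  have /existsNP[s /not_implyP[sB /contrapT[t [ts vE]]]] :
      ~ forall s, (forall y, y \in s -> B y \/ y = x) -> q s by move=> /Bmax.
  have [a [y [By vxy]]] : exists a y, spans B y /\ v = a *: x + y.
    rewrite vE; elim: t ts {vE} => [|p t IHt] ts.
      by exists 0, 0; rewrite big_nil scale0r addr0; split=> //; have [] := spanD B.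
    have [|a [y [By yE]]] := IHt; first by move=> r rt; apply: ts; rewrite inE rt orbT.
    rewrite big_cons yE; have [Bp|->] := sB _ (ts p (mem_head _ _)); last first.
      by exists (p.1 + a), y; rewrite scalerDl addrA.
    exists a, (p.1 *: p.2 + y); split; last by rewrite addrCA.
    apply: (spanD B).2 => //; exists [:: (1, p.2)].
    split; first by move=> r; rewrite inE => /eqP->.
    by rewrite big_seq1 scale1r.
  have a0 : a != 0.
    by apply/eqP => a0; apply: nBv; rewrite vxy a0 scale0r add0r.
  exists a^-1; have -> : x - a^-1 *: v = (- a^-1) *: y + 0.
    rewrite vxy scalerDr scalerA mulVf // scale1r opprD addrA subrr add0r addr0.
    by rewrite scaleNr.
  by apply: (spanD B).2 => //; have [] := spanD B.
have uniq_c x c d : spans B (x - c *: v) -> spans B (x - d *: v) -> c = d.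
  move=> Bc Bd; apply/eqP; rewrite -subr_eq0; apply/negPn/negP => cd; apply: nBv.
  have -> : v = (- (c - d)^-1) *: ((x - c *: v) + (-1) *: (x - d *: v)) + 0.
    rewrite addr0 scaleN1r opprB [_ + (d *: v - x)]addrC addrA subrK -scalerBl.
    by rewrite scalerA -[d - c]opprB mulrNN mulVf ?scale1r.
  apply: (spanD B).2; last by have [] := spanD B.
  by rewrite addrC; apply: (spanD B).2.
have [mu muP] := choice decomp; exists mu => [a x y|].
  apply: (uniq_c (a *: x + y)); first exact: muP.
  have -> : a *: x + y - (a * mu x + mu y) *: v
      = a *: (x - mu x *: v) + (y - mu y *: v).
    by rewrite scalerBr scalerDl scalerA opprD addrACA.
  exact: (spanD B).2.
apply: (uniq_c v); first exact: muP.
by rewrite scale1r subrr; have [] := spanD B.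
Qed.
End LinearAlgebra.

(** * Maps that are linear along a map of scalars *)

Section AdditiveHomogeneous.
Variables (K K' : fieldType) (iota : K -> K') (T : lmodType K) (U : lmodType K').
Variable g : T -> U.
Hypothesis gP : forall a x y, g (a *: x + y) = iota a *: g x + g y.
Hypothesis iota1 : iota 1 = 1.

(** With [iota] a bare map such that [iota 1 = 1], the same rules serve linear maps, maps into a
    scalar extension, and functionals with values in [k^o]. *)
Lemma semilinD x y : g (x + y) = g x + g y.
Proof. by rewrite -[x]scale1r gP iota1 !scale1r. Qed.

Lemma semilin0 : g 0 = 0.
Proof. by apply: (addrI (g 0)); rewrite -semilinD !addr0. Qed.

Lemma semilinZ a x : g (a *: x) = iota a *: g x.
Proof. by rewrite -[a *: x]addr0 gP semilin0 addr0. Qed.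

Lemma semilinB x y : g (x - y) = g x - g y.
Proof. by apply: (addIr (g y)); rewrite -semilinD !subrK. Qed.

Lemma semilin_sum (I : Type) (s : seq I) (F : I -> T) :
  g (\sum_(i <- s) F i) = \sum_(i <- s) g (F i).
Proof. exact: (big_morph g semilinD semilin0). Qed.

End AdditiveHomogeneous.

(** * Existence and properties of the scalar extension *)

Section ScalarExtension.
Variables (k K : fieldType) (iota : {rmorphism k -> K}) (V : lmodType k).

Definition tensor_eval (U : lmodType K) (f : V -> U) (s : seq (K * V)) : U :=
  \sum_(p <- s) p.1 *: f p.2.

(* Formal sums are identified when every semilinear map out of V agrees on them;
   the universal property is then immediate. *)
Definition tensor_eq (s t : seq (K * V)) : bool :=
  `[< forall (U : lmodType K) (f : V -> U), restr_linear iota f ->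
      tensor_eval f s = tensor_eval f t >].

Lemma tensor_eq_refl : reflexive tensor_eq.
Proof. by move=> s; apply/asboolP. Qed.
Lemma tensor_eq_sym : symmetric tensor_eq.
Proof. by move=> s t; apply/asboolP/asboolP => h U f /h->. Qed.
Lemma tensor_eq_trans : transitive tensor_eq.
Proof. by move=> t s r /asboolP h /asboolP h'; apply/asboolP => U f fP; rewrite h ?h'. Qed.

Canonical tensor_equiv :=
  EquivRel tensor_eq tensor_eq_refl tensor_eq_sym tensor_eq_trans.

Definition tensor := {eq_quot tensor_equiv}%qT.
HB.instance Definition _ := Choice.on tensor.
HB.instance Definition _ := EqQuotient.on tensor.

Definition tensor_lift (U : lmodType K) (f : V -> U) (x : tensor) : U :=
  tensor_eval f (repr x).

Lemma tensor_lift_pi (U : lmodType K) (f : V -> U) s : restr_linear iota f ->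
  tensor_lift f (\pi_(tensor)%qT s) = tensor_eval f s.
Proof.
move=> fP; rewrite /tensor_lift.
have /eqmodP/asboolP : (repr (\pi_(tensor) s) = s %[mod tensor])%qT by rewrite reprK.
exact.
Qed.

(** Semilinear maps separate the points of the quotient by construction. Each module axiom below is
    therefore checked after a lift to [U], where it already holds. *)
Lemma tensor_ext (x y : tensor) :
  (forall (U : lmodType K) (f : V -> U), restr_linear iota f ->
     tensor_lift f x = tensor_lift f y) -> x = y.
Proof.
by move=> h; rewrite -[x]reprK -[y]reprK; apply/eqmodP/asboolP.
Qed.

Definition tensor_scale (a : K) (x : tensor) : tensor :=
  \pi_(tensor)%qT [seq (a * p.1, p.2) | p <- repr x].
Definition tensor_add (x y : tensor) : tensor :=
  \pi_(tensor)%qT (repr x ++ repr y).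
Definition tensor_zero : tensor := \pi_(tensor)%qT [::].
Definition tensor_opp (x : tensor) : tensor := tensor_scale (-1) x.

Section Lift.
Variables (U : lmodType K) (f : V -> U).
Hypothesis fP : restr_linear iota f.

Lemma tensor_liftZ a x : tensor_lift f (tensor_scale a x) = a *: tensor_lift f x.
Proof.
rewrite tensor_lift_pi // /tensor_lift /tensor_eval big_map scaler_sumr.
by apply: eq_bigr => p _; rewrite scalerA.
Qed.

Lemma tensor_liftD x y :
  tensor_lift f (tensor_add x y) = tensor_lift f x + tensor_lift f y.
Proof. by rewrite tensor_lift_pi // /tensor_eval big_cat. Qed.

Lemma tensor_lift0 : tensor_lift f tensor_zero = 0.
Proof. by rewrite tensor_lift_pi // /tensor_eval big_nil. Qed.

Lemma tensor_liftN x : tensor_lift f (tensor_opp x) = - tensor_lift f x.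
Proof. by rewrite tensor_liftZ scaleN1r. Qed.
End Lift.

Fact tensor_addA : associative tensor_add.
Proof. by move=> x y z; apply: tensor_ext => U f fP; rewrite !tensor_liftD // addrA. Qed.
Fact tensor_addC : commutative tensor_add.
Proof. by move=> x y; apply: tensor_ext => U f fP; rewrite !tensor_liftD // addrC. Qed.
Fact tensor_add0 : left_id tensor_zero tensor_add.
Proof. by move=> x; apply: tensor_ext => U f fP; rewrite tensor_liftD // tensor_lift0 // add0r. Qed.
Fact tensor_addN : left_inverse tensor_zero tensor_opp tensor_add.
Proof.
by move=> x; apply: tensor_ext => U f fP;
rewrite tensor_liftD // tensor_liftN // tensor_lift0 // addNr.
Qed.

HB.instance Definition _ :=
  GRing.isZmodule.Build tensor tensor_addA tensor_addC tensor_add0 tensor_addN.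

Fact tensor_scaleA a b x : tensor_scale a (tensor_scale b x) = tensor_scale (a * b) x.
Proof. by apply: tensor_ext => U f fP; rewrite !tensor_liftZ // scalerA. Qed.
Fact tensor_scale1 : left_id 1 tensor_scale.
Proof. by move=> x; apply: tensor_ext => U f fP; rewrite tensor_liftZ // scale1r. Qed.
Fact tensor_scaleDr : right_distributive tensor_scale +%R.
Proof.
move=> a x y; apply: tensor_ext => U f fP.
by rewrite tensor_liftZ // !tensor_liftD // !tensor_liftZ // scalerDr.
Qed.
Fact tensor_scaleDl x : {morph tensor_scale^~ x : a b / a + b}.
Proof.
move=> a b; apply: tensor_ext => U f fP.
by rewrite tensor_liftZ // tensor_liftD // !tensor_liftZ // scalerDl.
Qed.

HB.instance Definition _ := GRing.Zmodule_isLmodule.Build K tensor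
  tensor_scaleA tensor_scale1 tensor_scaleDr tensor_scaleDl.

Definition tensor_in (v : V) : tensor := \pi_(tensor)%qT [:: (1, v)].

Lemma tensor_lift_in (U : lmodType K) (f : V -> U) v : restr_linear iota f ->
  tensor_lift f (tensor_in v) = f v.
Proof. by move=> fP; rewrite tensor_lift_pi // /tensor_eval big_seq1 scale1r. Qed.

Lemma tensor_lift_lin (U : lmodType K) (f : V -> U) : restr_linear iota f ->
  Klinear (tensor_lift f).
Proof. by move=> fP a x y; rewrite tensor_liftD // tensor_liftZ. Qed.

Lemma tensor_in_lin : restr_linear iota tensor_in.
Proof.
move=> a x y; apply: tensor_ext => U f fP.
by rewrite tensor_lift_lin // !tensor_lift_in // fP.
Qed.

Lemma tensor_span (t : tensor) : t = \sum_(p <- repr t) p.1 *: tensor_in p.2.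
Proof.
apply: tensor_ext => U f fP.
rewrite (semilin_sum (tensor_lift_lin fP)) //; apply: eq_bigr => p _.
by rewrite (semilinZ (tensor_lift_lin fP)) // tensor_lift_in.
Qed.

Lemma tensor_scalar_ext : scalar_ext iota tensor_in.
Proof.
split=> [|U f fP]; first exact: tensor_in_lin.
split=> [|g1 g2 g1P g2P g12 t].
  by exists (tensor_lift f); split=> [|v]; [exact: tensor_lift_lin|exact: tensor_lift_in].
rewrite (tensor_span t) (semilin_sum g1P) // (semilin_sum g2P) //.
by apply: eq_bigr => p _; rewrite (semilinZ g1P) // (semilinZ g2P) // g12.
Qed.

Variables (T : lmodType K) (j : V -> T).
Hypothesis Tj : scalar_ext iota j.

(** The composite of the canonical maps from [T] to [tensor] and back is the identity by uniqueness,
    so the spanning property of [tensor] passes to any [T] with the universal property. *)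
Lemma scalar_ext_span (t : T) : exists s : seq (K * V), t = \sum_(p <- s) p.1 *: j p.2.
Proof.
have [jP univ] := Tj.
have [[g [gP gj]] _] := univ _ _ tensor_in_lin.
have hP := tensor_lift_lin jP.
have <- : tensor_lift j (g t) = t.
  have [_ /(_ (fun x => tensor_lift j (g x)) id)] := univ _ _ jP; apply.
  - by move=> a x y; rewrite gP hP.
  - by move=> a x y.
  - by move=> v; rewrite gj tensor_lift_in.
by exists (repr (g t)).
Qed.

Lemma scalar_ext_uniq (U : lmodType K) (g1 g2 : T -> U) :
  Klinear g1 -> Klinear g2 -> (forall v, g1 (j v) = g2 (j v)) -> forall t, g1 t = g2 t.
Proof.
move=> g1P g2P g12 t; have [s ->] := scalar_ext_span t.
rewrite (semilin_sum g1P) // (semilin_sum g2P) //.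
by apply: eq_bigr => p _; rewrite (semilinZ g1P) // (semilinZ g2P) // g12.
Qed.

Lemma scalar_ext_lift (U : lmodType K) (f : V -> U) : restr_linear iota f ->
  exists2 g : T -> U, Klinear g & forall v, g (j v) = f v.
Proof. by move=> fP; have [_ /(_ U f fP)[[g []]]] := Tj; exists g. Qed.

End ScalarExtension.

(** * Endomorphisms of absolutely simple modules *)

Section Modules.
Variables (k : fieldType) (D : nualg k).

Lemma num_act0 (M : numod D) (d : D) : num_act d (0 : M) = 0.
Proof. by rewrite -[X in num_act d X](scale0r 0) num_actZr scale0r. Qed.

Lemma num_act0l (M : numod D) (x : M) : num_act (0 : D) x = 0.
Proof. by rewrite -(scale0r (0 : D)) num_actZl scale0r. Qed.

Lemma nua_mul0 (x : D) : nua_mul 0 x = 0.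
Proof. by rewrite -[X in nua_mul X _](scale0r (0 : D)) nua_mulZl scale0r. Qed.

Lemma nua_mulr0 (x : D) : nua_mul x 0 = 0.
Proof. by rewrite -[X in nua_mul _ X](scale0r (0 : D)) nua_mulZr scale0r. Qed.

Lemma num_act_lin (M : numod D) (d : D) (a : k) (x y : M) :
  num_act d (a *: x + y) = a *: num_act d x + num_act d y.
Proof. by rewrite num_actDr num_actZr. Qed.

Lemma num_actlin (M : numod D) (x : M) (a : k) (d e : D) :
  num_act (a *: d + e) x = a *: num_act d x + num_act e x.
Proof. by rewrite num_actDl num_actZl. Qed.

Definition simple_mod (M : numod D) : Prop := simple_ops (fun d : D => @num_act _ _ M d).

(** Take [K = k]: the module with its identity map is a scalar extension of itself. *)
Lemma abs_simple_simple (M : numod D) : abs_simple M -> simple_mod M.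
Proof.
move=> /(_ k idfun M id); apply=> [|d a x y|//].
- split=> // U f fP; split=> [|g1 g2 _ _ //].
  by exists f.
- exact: num_act_lin.
Qed.

Lemma simple_nonzero (M : numod D) : simple_mod M -> exists x : M, x <> 0.
Proof. by move=> [[d [x dx]] _]; exists x => x0; apply: dx; rewrite x0 num_act0. Qed.

(** The kernel and the image of [f] are submodules, so the kernel is zero and the image is [N]. *)
Lemma schur (M N : numod D) (f : M -> N) : simple_mod M -> simple_mod N ->
  mod_hom f -> (exists x, f x <> 0) ->
  exists2 g : N -> M, mod_hom g & cancel f g /\ cancel g f.
Proof.
move=> [_ simM] [_ simN] [flin fact] [x0 fx0].
have f0 : f 0 = 0 by apply: (semilin0 flin).
have kerf x : f x = 0 -> x = 0.
  have [||||inj0|all0] := simM (fun x => f x = 0).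
  - exact: f0.
  - by move=> x1 x2 h1 h2; rewrite (semilinD flin) // h1 h2 addr0.
  - by move=> a y h; rewrite (semilinZ flin) // h scaler0.
  - by move=> d y h; rewrite fact h num_act0.
  - exact: inj0.
  - by case: fx0; exact: all0.
have surf y : exists x, f x = y.
  move: y; have [||||im0|//] := simN (fun y => exists x, f x = y).
  - by exists 0.
  - by move=> _ _ [x <-] [y <-]; exists (x + y); rewrite (semilinD flin).
  - by move=> a _ [x <-]; exists (a *: x); rewrite (semilinZ flin).
  - by move=> d _ [x <-]; exists (num_act d x).
  - by case: fx0; apply: im0; exists x0.
have [g gK] := choice surf.
have finj : injective f.
  move=> x y fxy; apply/eqP; rewrite -subr_eq0; apply/eqP/kerf.
  by rewrite (semilinB flin) // fxy subrr.
exists g; last by split=> x //; apply: finj; rewrite gK.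
split=> [a x y|d x]; apply: finj; rewrite gK; first by rewrite flin !gK.
by rewrite fact gK.
Qed.

Lemma mod_hom_comp (M N P : numod D) (f : N -> P) (g : M -> N) :
  mod_hom f -> mod_hom g -> mod_hom (f \o g).
Proof.
move=> [fl fa] [gl ga]; split=> [a x y|d x] /=; first by rewrite gl fl.
by rewrite ga fa.
Qed.

(** * The bicommutant of an endomorphism as a field extension of [k] *)

Section Bicommutant.
Variables (M : numod D) (alpha : M -> M).
Hypotheses (simM : simple_mod M) (alphaP : mod_hom alpha).

(* By Schur's lemma the bicommutant of alpha in End_D(M) is a commutative field containing alpha. *)
Definition in_bicomm (f : M -> M) : Prop := mod_hom f /\
  forall g, mod_hom g -> (forall x, g (alpha x) = alpha (g x)) ->
  forall x, f (g x) = g (f x).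

Definition bicomm : Type := {f : M -> M | in_bicomm f}.
Definition bicomm_fun (f : bicomm) : M -> M := sval f.
Local Coercion bicomm_fun : bicomm >-> Funclass.

Lemma bicomm_ext (f g : bicomm) : f =1 g -> f = g.
Proof. by case: f g => [f fP] [g gP] /= fg; apply: eq_exist; apply/funext. Qed.

Lemma bicomm_lin (f : bicomm) (a : k) (x y : M) : f (a *: x + y) = a *: f x + f y.
Proof. by case: f => f [[]]. Qed.

Lemma bicomm_act (f : bicomm) (d : D) (x : M) : f (num_act d x) = num_act d (f x).
Proof. by case: f => f [[]]. Qed.

Lemma bicommC (f g : bicomm) x : f (g x) = g (f x).
Proof.
case: f g => [f [fh fC]] [g [gh gC]] /=; apply: fC => // y.
exact: gC.
Qed.

Lemma homD (f : M -> M) x y : mod_hom f -> f (x + y) = f x + f y.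
Proof. by move=> [fl _]; rewrite (semilinD fl). Qed.

Lemma scalar_in_bicomm (a : k) : in_bicomm (fun x => a *: x).
Proof.
split; first split=> [b x y|d x]; first by rewrite scalerDr !scalerA mulrC.
  by rewrite num_actZr.
by move=> g [gl _] _ x; rewrite (semilinZ gl).
Qed.
Definition bicomm_scalar a : bicomm := exist _ _ (scalar_in_bicomm a).

Lemma add_in_bicomm (f g : bicomm) : in_bicomm (fun x => f x + g x).
Proof.
case: f g => [f [[fl fa] fC]] [g [[gl ga] gC]] /=.
split; first split=> [b x y|d x]; first by rewrite fl gl scalerDr addrACA.
  by rewrite fa ga num_actDr.
by move=> h hh hC x; rewrite fC // gC // homD.
Qed.
Definition bicomm_add f g : bicomm := exist _ _ (add_in_bicomm f g).

Lemma mul_in_bicomm (f g : bicomm) : in_bicomm (f \o g).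
Proof.
case: f g => [f [fh fC]] [g [gh gC]] /=; split; first exact: mod_hom_comp.
by move=> h hh hC x /=; rewrite gC // fC.
Qed.
Definition bicomm_mul f g : bicomm := exist _ _ (mul_in_bicomm f g).

Definition bicomm_one := bicomm_scalar 1.
Definition bicomm_zero := bicomm_scalar 0.
Definition bicomm_opp (f : bicomm) := bicomm_mul (bicomm_scalar (-1)) f.

HB.instance Definition _ := gen_eqMixin bicomm.
HB.instance Definition _ := gen_choiceMixin bicomm.

Fact bicomm_addA : associative bicomm_add.
Proof. by move=> f g h; apply: bicomm_ext => x; exact: addrA. Qed.
Fact bicomm_addC : commutative bicomm_add.
Proof. by move=> f g; apply: bicomm_ext => x; exact: addrC. Qed.
Fact bicomm_add0 : left_id bicomm_zero bicomm_add.
Proof. by move=> f; apply: bicomm_ext => x /=; rewrite /bicomm_fun /= scale0r add0r. Qed.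
Fact bicomm_addN : left_inverse bicomm_zero bicomm_opp bicomm_add.
Proof.
by move=> f; apply: bicomm_ext => x /=; rewrite /bicomm_fun /= scaleN1r scale0r addNr.
Qed.

HB.instance Definition _ :=
  GRing.isZmodule.Build bicomm bicomm_addA bicomm_addC bicomm_add0 bicomm_addN.

Fact bicomm_mulA : associative bicomm_mul.
Proof. by move=> f g h; apply: bicomm_ext. Qed.
Fact bicomm_mulC : commutative bicomm_mul.
Proof. by move=> f g; apply: bicomm_ext => x; exact: bicommC. Qed.
Fact bicomm_mul1 : left_id bicomm_one bicomm_mul.
Proof. by move=> f; apply: bicomm_ext => x; exact: scale1r. Qed.
Fact bicomm_mulDl : left_distributive bicomm_mul bicomm_add.
Proof. by move=> f g h; apply: bicomm_ext. Qed.
Fact bicomm_one_neq0 : bicomm_one != 0.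
Proof.
apply/eqP => e10; have [x x0] := simple_nonzero simM; apply: x0.
have /= := congr1 (fun f : bicomm => f x) e10.
by rewrite /bicomm_fun /= scale1r scale0r.
Qed.

HB.instance Definition _ := GRing.Zmodule_isComNzRing.Build bicomm
  bicomm_mulA bicomm_mulC bicomm_mul1 bicomm_mulDl bicomm_one_neq0.

(** The inverse given by Schur's lemma stays in the bicommutant, since whatever commutes with [f]
    commutes with its inverse. The second conjunct fixes the inverse of zero to be zero, as the
    field structure demands. *)
Lemma bicomm_left_inverse (f : bicomm) : exists g : bicomm,
  (f != 0 -> g * f = 1) /\ (f = 0 -> g = 0).
Proof.
have [->|f0] := eqVneq f 0; first by exists 0.
have fx : exists x, f x <> 0.
  apply: contrapT => nf; move/eqP: f0; apply; apply: bicomm_ext => x.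
  by rewrite /bicomm_fun /= scale0r; apply: contrapT => fx; apply: nf; exists x.
have fh : mod_hom f by case: f {f0 fx} => f [].
have [g gh [fgK gfK]] := schur simM simM fh fx.
have gC : in_bicomm g.
  split=> // h hh hC x; apply: (can_inj fgK).
  have [_ fC] := svalP f.
  by rewrite gfK -[in LHS](gfK x); exact/esym/fC.
exists (exist _ _ gC); split=> [_|fE]; last by rewrite fE eqxx in f0.
apply: bicomm_ext => x.
by rewrite /bicomm_fun /= scale1r; exact: fgK.
Qed.

Definition bicomm_inv f : bicomm := sval (cid (bicomm_left_inverse f)).
Fact bicomm_mulVf f : f != 0 -> bicomm_inv f * f = 1.
Proof. by rewrite /bicomm_inv; case: cid => g []. Qed.
Fact bicomm_inv0 : bicomm_inv 0 = 0.
Proof. by rewrite /bicomm_inv; case: cid => /= g [_ /(_ erefl)]. Qed.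

HB.instance Definition _ :=
  GRing.ComNzRing_isField.Build bicomm bicomm_mulVf bicomm_inv0.

Fact bicomm_scalar_additive : zmod_morphism bicomm_scalar.
Proof.
move=> a b; apply: bicomm_ext => x.
by rewrite /bicomm_fun /= scaleN1r scalerBl.
Qed.
Fact bicomm_scalar_multiplicative : monoid_morphism bicomm_scalar.
Proof.
split=> // a b; apply: bicomm_ext => x.
by rewrite /bicomm_fun /= scalerA.
Qed.
HB.instance Definition _ :=
  GRing.isZmodMorphism.Build k bicomm bicomm_scalar bicomm_scalar_additive.
HB.instance Definition _ :=
  GRing.isMonoidMorphism.Build k bicomm bicomm_scalar bicomm_scalar_multiplicative.

(** A copy of [M], so that its structure of vector space over [bicomm], by evaluation, is kept apart
    from the one over [k]. *)
Definition bicomm_mod : Type := M.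
HB.instance Definition _ := GRing.Zmodule.copy bicomm_mod M.
Definition bicomm_scale (f : bicomm) (x : bicomm_mod) : bicomm_mod := f x.

Fact bicomm_scaleA a b v :
  bicomm_scale a (bicomm_scale b v) = bicomm_scale (a * b) v.
Proof. by []. Qed.
Fact bicomm_scale1 : left_id 1 bicomm_scale.
Proof. by move=> x; exact: scale1r. Qed.
Fact bicomm_scaleDr : right_distributive bicomm_scale +%R.
Proof. by move=> f x y; apply: (semilinD (bicomm_lin f)). Qed.
Fact bicomm_scaleDl v : {morph bicomm_scale^~ v : a b / a + b}.
Proof. by []. Qed.
HB.instance Definition _ := GRing.Zmodule_isLmodule.Build bicomm bicomm_mod
  bicomm_scaleA bicomm_scale1 bicomm_scaleDr bicomm_scaleDl.

Lemma alpha_in_bicomm : in_bicomm alpha.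
Proof. by split=> // g _ gC x; rewrite gC. Qed.

(* The action map K (x) M -> M kills alpha (x) n - 1 (x) alpha n, which is
   nonzero unless alpha is a scalar. *)
Lemma abs_simple_scalar : abs_simple M -> exists c : k, forall x, alpha x = c *: x.
Proof.
move=> absM; pose K : fieldType := bicomm; pose iota : {rmorphism k -> K} := bicomm_scalar.
pose T : lmodType K := tensor iota M; pose j : M -> T := tensor_in iota (V := M).
have Tj : scalar_ext iota j by exact: tensor_scalar_ext.
have jlin : restr_linear iota j by have [] := Tj.
(* [rho d] is the operator $1\otimes d$. *)
have /choice[rho rhoP] (d : D) : exists r : T -> T,
    Klinear r /\ forall m, r (j m) = j (num_act d m).
  have [|r r1 r2] := scalar_ext_lift Tj (f := fun m => j (num_act d m)).
    by move=> a x y; rewrite num_act_lin jlin.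
  by exists r.
have [_ sim] : simple_ops rho by apply: absM Tj _ _ _ => d; have [] := rhoP d.
(* [g] is the action map $K\otimes M\to M$; it commutes with [D], so its kernel is a submodule. *)
have [|g glin gj] := scalar_ext_lift Tj (U := bicomm_mod) (f := id); first by [].
have [n n0] := simple_nonzero simM.
have [mu mulin mun] := functional_nonzero n0.
pose al : K := exist _ _ alpha_in_bicomm.
have grho d t : g (rho d t) = num_act d (g t : M).
  have [rlin rj] := rhoP d; move: t.
  apply: (scalar_ext_uniq Tj (g1 := g \o rho d) (g2 := fun t => num_act d (g t : M) : bicomm_mod)).
  - by move=> a x y /=; rewrite rlin glin.
  - move=> a x y /=; rewrite glin num_actDr; congr (_ + _).
    by rewrite -(bicomm_act a).
  - by move=> m /=; rewrite rj !gj.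
have [||||S0|Sall] := sim (fun t => g t = 0).
- exact: (semilin0 glin).
- by move=> x y hx hy; rewrite (semilinD glin) // hx hy addr0.
- by move=> a x hx; rewrite (semilinZ glin) // hx scaler0.
- by move=> d x hx; rewrite grho hx; exact: num_act0.
- have t0 : al *: j n - j (alpha n) = 0.
    by apply: S0; rewrite (semilinB glin) // (semilinZ glin) // !gj; exact: subrr.
  (* Applying $1\otimes\mu$ with [mu n = 1] turns the vanishing tensor into the equality of [al]
     with the scalar [mu (alpha n)] in [K]. *)
  have [|h hlin hj] := scalar_ext_lift Tj (U := K^o) (f := fun x => iota (mu x)).
    by move=> a x y; rewrite mulin rmorphD rmorphM.
  have := congr1 h t0; rewrite (semilin0 hlin) // (semilinB hlin) // (semilinZ hlin) // !hj.
  rewrite mun rmorph1 => /eqP; rewrite subr_eq0 => /eqP alE.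
  exists (mu (alpha n)) => x; have /= := congr1 (fun f : bicomm => f x) alE.
  rewrite /bicomm_fun /= => <-; by rewrite scale1r.
(* The kernel cannot be everything, because [g (j n) = n] is nonzero. *)
- by case: n0; rewrite -(gj n); exact: Sall.
Qed.

End Bicommutant.
End Modules.

(** * Classification *)

Section Classification.
Variables (k : fieldType) (D : nualg k).

Definition regular_mod : numod D :=
  @NUMod k D D (@nua_mul k D) (@nua_mulDl k D) (@nua_mulDr k D)
    (@nua_mulZl k D) (@nua_mulZr k D) (fun d e m => esym (nua_mulA d e m)).

Lemma regular_mod_unital : has_local_units D -> unital_mod regular_mod.
Proof.
move=> LU m; have [e [_ /(_ m)[|em _]]] := LU [:: m]; first by left.
by exists [:: (e, m)]; rewrite big_seq1 /= em.
Qed.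

(** For simple modules this is isomorphism, by Schur's lemma. *)
Definition mod_equiv (M N : numod D) : Prop :=
  exists2 f : M -> N, mod_hom f & exists x, f x <> 0.

Lemma mod_equiv_refl (M : numod D) : simple_mod M -> mod_equiv M M.
Proof. by move=> /simple_nonzero[x x0]; exists id => //; exists x. Qed.

Lemma mod_equiv_sym (M N : numod D) : simple_mod M -> simple_mod N ->
  mod_equiv M N -> mod_equiv N M.
Proof.
move=> simM simN [f fh fx]; have [g gh [fK gK]] := schur simM simN fh fx.
exists g => //; have [y y0] := simple_nonzero simN; exists y => gy; apply: y0.
by rewrite -(gK y) gy (semilin0 fh.1).
Qed.

Lemma mod_equiv_trans (M N P : numod D) : simple_mod M -> simple_mod N ->
  mod_equiv M N -> mod_equiv N P -> mod_equiv M P.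
Proof.
move=> simM simN [f fh fx] [g gh [y gy]].
have [f' _ [_ f'K]] := schur simM simN fh fx.
by exists (g \o f); [exact: mod_hom_comp|exists (f' y); rewrite /= f'K].
Qed.

(** * Isomorphism classes of the simple summands of [D] *)

Section Decomposition.
Variables (J : Type) (N : J -> numod D) (inj : forall j, N j -> D).
Hypotheses (LU : has_local_units D) (absN : forall j, abs_simple (N j)).
Hypothesis inj_hom : forall j, mod_hom (@inj j : N j -> regular_mod).
Hypothesis inj_span : forall d : D, exists s : seq {j : J & N j},
  d = \sum_(p <- s) inj (projT2 p).

Let simN j : simple_mod (N j) := abs_simple_simple (@absN j).

Lemma summand_ind (P : D -> Prop) : P 0 -> (forall x y, P x -> P y -> P (x + y)) ->
  (forall j n, P (@inj j n)) -> forall d, P d.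
Proof. by move=> P0 PD PJ d; have [s ->] := inj_span d; apply: big_ind. Qed.

(** The choice is made from the predicate describing the isomorphism class, not from [j]. Isomorphic
    summands have extensionally equal predicates, hence the same representative. *)
Lemma summand_representatives : exists rep : J -> J,
  (forall j, mod_equiv (N j) (N (rep j))) /\
  (forall j j', mod_equiv (N j) (N j') -> rep j = rep j').
Proof.
have [|pick pickP] := @choice {P : J -> Prop | exists j, P j} J (fun P j => sval P j).
  by case.
have ex j : exists j', mod_equiv (N j) (N j').
  by exists j; exact: mod_equiv_refl.
exists (fun j => pick (exist _ _ (ex j))); split=> [j|j j' jj'].
  exact: pickP (exist _ _ (ex j)).
congr pick; apply: eq_exist; apply/funext => i; apply: propext; split.
  by apply: mod_equiv_trans => //; exact: mod_equiv_sym.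
exact: mod_equiv_trans.
Qed.

Variable rep : J -> J.
Hypothesis rep_equiv : forall j, mod_equiv (N j) (N (rep j)).
Hypothesis rep_eq : forall j j', mod_equiv (N j) (N j') -> rep j = rep j'.

(** Fixed points of [rep] give exactly one summand per isomorphism class. *)
Definition iso_class : Type := {j : J | rep j = j}.
Definition class_mod (i : iso_class) : numod D := N (sval i).

Lemma class_mod_inj (i i' : iso_class) :
  mod_equiv (class_mod i) (class_mod i') -> i = i'.
Proof.
case: i i' => [i iP] [i' iP'] /= /rep_eq; rewrite iP iP' => ii'.
exact: eq_exist.
Qed.

Lemma class_of_summand j : exists i, mod_equiv (N j) (class_mod i).
Proof.
have rj : rep (rep j) = rep j by apply/esym/rep_eq.
by exists (exist (fun j => rep j = j) _ rj).
Qed.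

Definition rank_one_at (i : iso_class) (v : class_mod i) (w : class_mod i -> k) (d : D) :=
  (forall x : class_mod i, num_act d x = w x *: v) /\
  forall i', i' <> i -> forall x : class_mod i', num_act d x = 0.

(** This is $W_i$, read off from [D]: all rank one operators with functional [w] must come from
    elements of [D] that kill the other classes. Surjectivity of the isomorphism is thus built in,
    and the work goes into showing that there are enough such functionals. *)
Definition class_dual (i : iso_class) (w : class_mod i -> k) : Prop :=
  (forall a x y, w (a *: x + y) = a * w x + w y) /\
  forall v, exists d, rank_one_at v w d.

Lemma summand_rank_one j : exists (i : iso_class) (phi : N j -> class_mod i) w,
  class_dual w /\ forall n, rank_one_at (phi n) w (inj n).
Proof.
have [i [phi phih phix]] := class_of_summand j.
have simi : simple_mod (class_mod i) by exact: simN.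
have [psi psih [phiK psiK]] := schur (simN j) simi phih phix.
have [n0 phin0] := phix.
have acth (V : numod D) (x : V) : mod_hom (fun n : N j => num_act (inj n) x).
  have [il ia] := inj_hom j.
  split=> [a m n|d n]; first by rewrite il num_actlin.
  by rewrite ia /= num_actA.
(* x |-> (n |-> n x) lands in Hom_D(N_j, V_i), which is the line spanned by phi. *)
have /choice[w wP] (x : class_mod i) :
    exists c : k, forall n, num_act (inj n) x = c *: phi n.
  have [c cP] := abs_simple_scalar simi (mod_hom_comp (acth _ x) psih) (@absN _).
  by exists c => n; rewrite -cP /= phiK.
(* A nonzero action on another class [i'] would make [N j] isomorphic to both [class_mod i] and
   [class_mod i']. *)
have rk n : rank_one_at (phi n) w (inj n).
  split=> // i' ii' x; apply: contrapT => nx; apply: ii'.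
  have ji' : mod_equiv (N j) (class_mod i').
    by exists (fun n : N j => num_act (inj n) x); [exact: acth|exists n].
  apply/esym/class_mod_inj; apply: mod_equiv_trans ji' => //.
  by apply: mod_equiv_sym => //; exists phi.
exists i, phi, w; split=> //; split=> [a x y|v]; last first.
  by exists (inj (psi v)); rewrite -[in X in rank_one_at X](psiK v).
(* Linearity of [w] is inherited from the action of [inj n0], as [phi n0] is nonzero. *)
apply/eqP; rewrite -subr_eq0; apply: contrapT => /negP c0; apply: phin0.
have /eqP : (w (a *: x + y) - (a * w x + w y)) *: phi n0 = 0.
  by rewrite scalerBl scalerDl -scalerA -!wP num_act_lin subrr.
by rewrite scaler_eq0 (negPf c0) /= => /eqP.
Qed.

(** The vectors killed by [D] form a proper submodule, hence zero. So some element of some summand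
    does not kill [v - v'], and the functional attached to that summand separates the two
    vectors. *)
Lemma class_dual_separating (i : iso_class) : separating_dual_subspace (@class_dual i).
Proof.
split; first by move=> w [].
split.
  split=> [a x y|v]; first by rewrite mulr0 addr0.
  by exists 0; split=> [x|i' _ x]; rewrite num_act0l ?scale0r.
split.
  move=> w1 w2 [l1 T1] [l2 T2]; split=> [a x y|v].
    by rewrite l1 l2 mulrDr addrACA.
  have [d1 [d1E d1O]] := T1 v; have [d2 [d2E d2O]] := T2 v.
  exists (d1 + d2); split=> [x|i' ii' x]; first by rewrite num_actDl d1E d2E scalerDl.
  by rewrite num_actDl d1O // d2O // addr0.
split.
  move=> a w [l T]; split=> [b x y|v].
    by rewrite l mulrDr mulrCA.
  have [d [dE dO]] := T v.
  exists (a *: d); split=> [x|i' ii' x]; first by rewrite num_actZl dE scalerA.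
  by rewrite num_actZl dO // scaler0.
move=> v v' vv'.
have [d dv] : exists d : D, num_act d (v - v' : class_mod i) <> 0.
  apply: contrapT => nd; have [[d [x dx]] sim] := simN (sval i).
  have [||||S0|Sall] := sim (fun x => forall d : D, num_act d x = 0).
  - by move=> e; rewrite num_act0.
  - by move=> y z hy hz e; rewrite num_actDr hy hz addr0.
  - by move=> a y hy e; rewrite num_actZr hy scaler0.
  - by move=> e y hy f; rewrite hy num_act0.
  - apply: vv'; apply/eqP; rewrite -subr_eq0; apply/eqP; apply: S0 => e.
    by apply: contrapT => ev; apply: nd; exists e.
  - exact: dx (Sall x d).
have [j [n nv]] : exists j, exists n : N j, num_act (inj n) (v - v' : class_mod i) <> 0.
  apply: contrapT => nj; apply: dv; elim/summand_ind: d.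
  - by rewrite num_act0l.
  - by move=> d e hd he; rewrite num_actDl hd he addr0.
  - by move=> j n; apply: contrapT => h; apply: nj; exists j, n.
have [i' [phi [w [wd wP]]]] := summand_rank_one j.
have [ii'|ii'] := pselect (i = i'); last by case: nv; apply: (wP n).2.
move: wd wP => {}+ +; case: _ / ii' phi w => phi w wd wP.
exists w; split=> // wvv'; apply: nv.
by rewrite (wP n).1 (@semilinB k k id _ k^o w wd.1) // wvv' subrr scale0r.
Qed.

Lemma classification_iso :
  @dsum_MW_iso k D iso_class class_mod class_dual (fun i d x => num_act d x).
Proof.
split; first by move=> i d e v; rewrite num_actDl.
split; first by move=> i a d v; rewrite num_actZl.
split; first by move=> i d e v; rewrite num_actA.
split.
  move=> d d0.
  (* An element killing every class kills every summand, hence all of [D] under left multiplication;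
     a right local unit then gives [d = 0]. *)
  have dN j (n : N j) : num_act d n = 0.
    have [i ji] := class_of_summand j.
    have [f fh fx] := ji; have [g [_ gact] [fK _]] := schur (simN j) (simN (sval i)) fh fx.
    by rewrite -(fK n) -gact d0 -[RHS](fK 0) (semilin0 fh.1).
  have [e [_ /(_ d)[|_ de]]] := LU [:: d]; first by left.
  rewrite -de; elim/summand_ind: e {de}.
  - by rewrite nua_mulr0.
  - by move=> x y hx hy; rewrite nua_mulDr hx hy addr0.
  - move=> j n; have [il ia] := inj_hom j.
    by rewrite -[LHS]ia dN; exact: (semilin0 il).
split.
  elim/summand_ind.
  - by exists [::] => i _ v; exact: num_act0l.
  - move=> d e [s ds] [t et]; exists (s ++ t) => i ist v.
    rewrite num_actDl ds ?et ?addr0 // => h; apply: ist; apply: List.in_or_app.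
      by right.
    by left.
  - move=> j n; have [i [phi [w [_ wP]]]] := summand_rank_one j.
    by exists [:: i] => i' ii' v; apply: (wP n).2 => ii; apply: ii'; left.
split.
  move=> i; elim/summand_ind.
  - by exists [::]; split=> // x; rewrite big_nil num_act0l.
  - move=> d e [s [sW ds]] [t [tW et]]; exists (s ++ t).
    split=> [p pst|x]; first by case: (List.in_app_or _ _ _ pst); [exact: sW|exact: tW].
    by rewrite num_actDl ds et big_cat.
  - move=> j n; have [i' [phi [w [wd wP]]]] := summand_rank_one j.
    have [ii'|ii'] := pselect (i = i'); last first.
      by exists [::]; split=> // x; rewrite big_nil; apply: (wP n).2.
    move: wd wP; case: _ / ii' phi w => phi w wd wP.
    exists [:: (phi n, w)]; split=> [p [<-//|//]|x].
    by rewrite big_seq1 (wP n).1.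
move=> i f [s [sW fE]].
(* The definition of [class_dual] provides a preimage for each rank one term, and these preimages
   are added. *)
suff [d [dE dO]] : exists d : D,
    (forall v : class_mod i, num_act d v = \sum_(p <- s) T_op p.1 p.2 v) /\
    forall j, j <> i -> forall v : class_mod j, num_act d v = 0.
  by exists d; split=> // v; rewrite dE fE.
elim: s sW {fE} => [|p s IHs] sW.
  by exists 0; split=> [v|j _ v]; rewrite ?big_nil num_act0l.
have [|d [dE dO]] := IHs; first by move=> q qs; apply: sW; right.
have [|_ /(_ p.1)[e [eE eO]]] := sW p; first by left.
exists (e + d); split=> [v|j ji v]; first by rewrite num_actDl big_cons eE dE.
by rewrite num_actDl eO // dO // addr0.
Qed.

End Decomposition.

Theorem abs_semisimple_classification : has_local_units D -> abs_semisimple_alg D ->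
  exists (I : Type) (V : I -> lmodType k) (W : forall i, (V i -> k) -> Prop)
         (rho : forall i, D -> V i -> V i),
    (forall i, separating_dual_subspace (W i)) /\ @dsum_MW_iso k D I V W rho.
Proof.
move=> LU SS.
have [J [N [inj [absN [injh [_ span]]]]]] := SS _ (regular_mod_unital LU).
have [rep [rep1 rep2]] := summand_representatives absN.
exists (iso_class rep), (fun i => class_mod N i), (@class_dual J N rep).
exists (fun i d x => num_act d x); split.
  by move=> i; exact: (class_dual_separating absN injh span rep1 rep2).
exact: (classification_iso LU absN injh span rep1 rep2).
Qed.

End Classification.

(** * Direct sums of algebras of finite rank operators *)

Section FiniteRank.
Variables (k : fieldType) (V : lmodType k) (W : (V -> k) -> Prop).

Lemma in_MW0 : in_MW W (fun=> 0).
Proof. by exists [::]; split=> // x; rewrite big_nil. Qed.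

Lemma in_MWD f g : in_MW W f -> in_MW W g -> in_MW W (fun x => f x + g x).
Proof.
move=> [s [sW fE]] [t [tW gE]]; exists (s ++ t); split=> [p pst|x].
  by case: (List.in_app_or _ _ _ pst); [exact: sW|exact: tW].
by rewrite fE gE big_cat.
Qed.

Lemma in_MWZ a f : in_MW W f -> in_MW W (fun x => a *: f x).
Proof.
move=> [s [sW fE]]; exists [seq (a *: p.1, p.2) | p <- s]; split.
  by move=> p /List.in_map_iff[q [<- /sW]].
move=> x; rewrite fE scaler_sumr big_map; apply: eq_bigr => p _.
by rewrite /T_op !scalerA mulrC.
Qed.

Lemma in_MW_T v w : W w -> in_MW W (T_op v w).
Proof.
by move=> Ww; exists [:: (v, w)]; split=> [p [<-//|//]|x]; rewrite big_seq1.
Qed.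

Hypothesis sepW : separating_dual_subspace W.

Lemma dual_lin w : W w -> forall a x y, w (a *: x + y) = a * w x + w y.
Proof. by case: sepW => + _; apply. Qed.

Lemma dualB w x y : W w -> w (x - y) = w x - w y.
Proof. by move=> Ww; exact: (@semilinB k k id _ k^o w (dual_lin Ww)). Qed.

Lemma dualZ w a x : W w -> w (a *: x) = a * w x.
Proof. by move=> Ww; exact: (@semilinZ k k id _ k^o w (dual_lin Ww)). Qed.

Lemma dual0 w : W w -> w 0 = 0.
Proof. by move=> Ww; exact: (@semilin0 k k id _ k^o w (dual_lin Ww)). Qed.

Lemma dual_sub w1 w2 : W w1 -> W w2 -> W (fun x => w1 x - w2 x).
Proof.
move=> h1 h2; have [_ [_ [WD [WZ _]]]] := sepW.
by apply: (WD _ _ h1); under eq_fun do rewrite -mulN1r; exact: WZ.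
Qed.

Lemma in_MW_lin f : in_MW W f -> forall a x y, f (a *: x + y) = a *: f x + f y.
Proof.
move=> [s [sW fE]] a x y; rewrite !fE scaler_sumr -big_split /=.
elim: s sW {fE} => [|p s IHs] sW; first by rewrite !big_nil.
rewrite !big_cons IHs => [|q qs]; last by apply: sW; right.
congr (_ + _); rewrite /T_op dual_lin; last by apply: sW; left.
by rewrite scalerDl scalerA.
Qed.

Lemma in_MW_comp f g : in_MW W f -> in_MW W g -> in_MW W (fun x => f (g x)).
Proof.
move=> /in_MW_lin fl [s [sW gE]]; exists [seq (f p.1, p.2) | p <- s]; split.
  by move=> p /List.in_map_iff[q [<- /sW]].
move=> x; rewrite gE (semilin_sum fl) // big_map; apply: eq_bigr => p _.
by rewrite /T_op (semilinZ fl).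
Qed.

(** The transpose of $T_{v,u}$ sends $w$ to $w(v)u$, so [W] is stable under transposes and carries a
    right action. *)
Lemma in_MW_dual w f : W w -> in_MW W f -> W (fun x => w (f x)).
Proof.
have [_ [W0 [WD [WZ _]]]] := sepW.
move=> Ww [s [sW /funext->]]; elim: s sW => [|p s IHs] sW.
  by under eq_fun do rewrite big_nil dual0 //.
have -> : (fun x => w (\sum_(q <- p :: s) T_op q.1 q.2 x)) =
    (fun x => w p.1 * p.2 x + w (\sum_(q <- s) T_op q.1 q.2 x)).
  by apply/funext => x; rewrite big_cons dual_lin // mulrC.
apply: WD; first by apply: WZ; apply: sW; left.
by apply: IHs => q qs; apply: sW; right.
Qed.

Lemma dual_separate v : v <> 0 -> exists2 w, W w & w v = 1.
Proof.
have [_ [_ [_ [WZ sep]]]] := sepW.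
move=> /sep[w [Ww]]; rewrite dual0 // => /eqP wv.
by exists (fun x => (w v)^-1 * w x); [exact: WZ|rewrite mulVf].
Qed.

End FiniteRank.

(** * The direct sum as an algebra of finitely supported families *)

Section DirectSum.
Variables (k : fieldType) (I : Type) (V : I -> lmodType k).
Variable W : forall i, (V i -> k) -> Prop.

Definition in_dsum (f : forall i, V i -> V i) : Prop :=
  (exists s : seq I, forall i, ~ List.In i s -> forall v, f i v = 0) /\
  forall i, in_MW (@W i) (f i).

Definition dsum : Type := {f : forall i, V i -> V i | in_dsum f}.
Definition dsum_fun (f : dsum) : forall i, V i -> V i := sval f.
Local Coercion dsum_fun : dsum >-> Funclass.

Lemma dsum_ext (f g : dsum) : (forall i v, f i v = g i v) -> f = g.
Proof.
case: f g => [f fP] [g gP] /= fg; apply: eq_exist.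
by apply: functional_extensionality_dep => i; apply/funext => v; exact: fg.
Qed.

Fact in_dsum0 : in_dsum (fun i _ => 0).
Proof. by split=> [|i]; [exists [::]|exact: in_MW0]. Qed.
Definition dsum0 : dsum := exist _ _ in_dsum0.

Fact in_dsumD (f g : dsum) : in_dsum (fun i x => f i x + g i x).
Proof.
case: f g => [f [[s fs] fW]] [g [[t gt] gW]] /=; split=> [|i]; last exact: in_MWD.
exists (s ++ t) => i ist v; rewrite fs ?gt ?addr0 // => h.
  by apply: ist; apply: List.in_or_app; right.
by apply: ist; apply: List.in_or_app; left.
Qed.
Definition dsumD f g : dsum := exist _ _ (in_dsumD f g).

Fact in_dsumZ a (f : dsum) : in_dsum (fun i x => a *: f i x).
Proof.
case: f => [f [[s fs] fW]] /=; split=> [|i]; last exact: in_MWZ.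
by exists s => i ist v; rewrite fs // scaler0.
Qed.
Definition dsumZ a f : dsum := exist _ _ (in_dsumZ a f).

HB.instance Definition _ := gen_eqMixin dsum.
HB.instance Definition _ := gen_choiceMixin dsum.

Fact dsum_addA : associative dsumD.
Proof. by move=> f g h; apply: dsum_ext => i v; exact: addrA. Qed.
Fact dsum_addC : commutative dsumD.
Proof. by move=> f g; apply: dsum_ext => i v; exact: addrC. Qed.
Fact dsum_add0 : left_id dsum0 dsumD.
Proof. by move=> f; apply: dsum_ext => i v; exact: add0r. Qed.
Fact dsum_addN : left_inverse dsum0 (dsumZ (-1)) dsumD.
Proof.
by move=> f; apply: dsum_ext => i v; rewrite /dsum_fun /= scaleN1r addNr.
Qed.
HB.instance Definition _ :=
  GRing.isZmodule.Build dsum dsum_addA dsum_addC dsum_add0 dsum_addN.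

Fact dsum_scaleA a b f : dsumZ a (dsumZ b f) = dsumZ (a * b) f.
Proof. by apply: dsum_ext => i v; exact: scalerA. Qed.
Fact dsum_scale1 : left_id 1 dsumZ.
Proof. by move=> f; apply: dsum_ext => i v; exact: scale1r. Qed.
Fact dsum_scaleDr : right_distributive dsumZ +%R.
Proof. by move=> a f g; apply: dsum_ext => i v; exact: scalerDr. Qed.
Fact dsum_scaleDl f : {morph dsumZ^~ f : a b / a + b}.
Proof. by move=> a b; apply: dsum_ext => i v; exact: scalerDl. Qed.
HB.instance Definition _ := GRing.Zmodule_isLmodule.Build k dsum
  dsum_scaleA dsum_scale1 dsum_scaleDr dsum_scaleDl.

Hypothesis sepW : forall i, separating_dual_subspace (@W i).

Fact in_dsumM (f g : dsum) : in_dsum (fun i x => f i (g i x)).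
Proof.
have fW i : in_MW (@W i) (f i) by case: f => [f []].
case: g => [g [[s gs] gW]] /=; split=> [|i]; last exact: in_MW_comp.
by exists s => i ist v; rewrite gs // (semilin0 (in_MW_lin (sepW i) (fW i))).
Qed.
Definition dsumM f g : dsum := exist _ _ (in_dsumM f g).

Lemma dsum_lin (f : dsum) i a x y : f i (a *: x + y) = a *: f i x + f i y.
Proof. by move: a x y; apply: in_MW_lin => //; case: f => [f []]. Qed.

Fact dsum_mulA f g h : dsumM f (dsumM g h) = dsumM (dsumM f g) h.
Proof. exact: dsum_ext. Qed.
Fact dsum_mulDl (f g h : dsum) : dsumM (f + g) h = dsumM f h + dsumM g h.
Proof. exact: dsum_ext. Qed.
Fact dsum_mulDr (f g h : dsum) : dsumM f (g + h) = dsumM f g + dsumM f h.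
Proof. by apply: dsum_ext => i x; exact: (semilinD (dsum_lin f (i := i))). Qed.
Fact dsum_mulZl a (f g : dsum) : dsumM (a *: f) g = a *: dsumM f g.
Proof. exact: dsum_ext. Qed.
Fact dsum_mulZr a (f g : dsum) : dsumM f (a *: g) = a *: dsumM f g.
Proof. by apply: dsum_ext => i x; exact: (semilinZ (dsum_lin f (i := i))). Qed.

Definition dsum_alg : nualg k :=
  NUAlg dsum_mulA dsum_mulDl dsum_mulDr dsum_mulZl dsum_mulZr.

Lemma dsum_alg_iso : @dsum_MW_iso k dsum_alg I V W (fun i d x => dsum_fun d x).
Proof.
do 3!split=> //; split; first by move=> d d0; apply: dsum_ext.
split; first by move=> [f [fs]].
split; first by move=> i [f [fs]].
move=> i f fW.
(* [f] is extended by zero to the other indices. Equality in [I] is decided classically, and proof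
   irrelevance removes the transport at [i]. *)
pose g j : V j -> V j := match pselect (i = j) with
  | left e => eq_rect i (fun j => V j -> V j) f j e
  | right _ => fun=> 0 end.
have gi v : g i v = f v.
  by rewrite /g; case: pselect => // e; rewrite (Prop_irrelevance e erefl).
have gj j : j <> i -> forall v, g j v = 0.
  by move=> ji v; rewrite /g; case: pselect => // e; case: ji.
have gP : in_dsum g.
  split=> [|j]; first by exists [:: i] => j ji; apply: gj => e; apply: ji; left.
  have [<-|ij] := pselect (i = j); first by move: fW; congr in_MW; apply/funext.
  by rewrite (_ : g j = fun=> 0); [exact: in_MW0|apply/funext/gj => ji; exact: ij].
by exists (exist _ _ gP).
Qed.

End DirectSum.

(** * Local units, simplicity of the $V_i$, and decomposition of unital modules *)

Section DirectSumAlgebra.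
Variables (k : fieldType) (I : Type) (V : I -> lmodType k).
Variable W : forall i, (V i -> k) -> Prop.
Hypothesis sepW : forall i, separating_dual_subspace (@W i).
Variables (D : nualg k) (rho : forall i, D -> V i -> V i).
Arguments rho : clear implicits.
Hypothesis isoD : @dsum_MW_iso k D I V W rho.

Local Notation "d ** e" := (@nua_mul k D d e) (at level 40, left associativity).

Lemma rhoD i (d e : D) v : rho i (d + e) v = rho i d v + rho i e v.
Proof. by case: isoD. Qed.

Lemma rhoZ i a (d : D) v : rho i (a *: d) v = a *: rho i d v.
Proof. by case: isoD => _ []. Qed.

Lemma rhoM i (d e : D) v : rho i (d ** e) v = rho i d (rho i e v).
Proof. by case: isoD => _ [_ []]. Qed.

Lemma rho_faithful (d e : D) : (forall i v, rho i d v = rho i e v) -> d = e.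
Proof.
case: isoD => _ [_ [_ [faith _]]] de; apply/eqP; rewrite -subr_eq0; apply/eqP.
by apply: faith => i v; rewrite -scaleN1r rhoD rhoZ de scaleN1r subrr.
Qed.

Lemma rho_MW i (d : D) : in_MW (@W i) (rho i d).
Proof. by case: isoD => _ [_ [_ [_ [_ []]]]]. Qed.

Lemma rho_lin i (d : D) a x y : rho i d (a *: x + y) = a *: rho i d x + rho i d y.
Proof. by move: a x y; apply: in_MW_lin (sepW i) _ _; exact: rho_MW. Qed.

Lemma rho0l i v : rho i (0 : D) v = 0.
Proof. by rewrite -(scale0r (0 : D)) rhoZ scale0r. Qed.

(** [tau i v w] is the copy of $T_{v,w}$ in the summand [i]; it is unconstrained when [w] lies
    outside [W i]. *)
Lemma exists_tau : exists tau : forall i, V i -> (V i -> k) -> D,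
  forall i v w, W w -> (forall x, rho i (tau i v w) x = w x *: v) /\
    forall j, j <> i -> forall x, rho j (tau i v w) x = 0.
Proof.
have [|t tP] := @choice {i : I & V i * (V i -> k)}%type D (fun p d => W (projT2 p).2 ->
    (forall x, rho (projT1 p) d x = (projT2 p).2 x *: (projT2 p).1) /\
    forall j, j <> projT1 p -> forall x, rho j d x = 0).
  move=> [i [v w]] /=; have [Ww|nW] := pselect (W w); last by exists 0.
  have [_ [_ [_ [_ [_ [_ /(_ i _ (in_MW_T v Ww))[d dP]]]]]]] := isoD.
  by exists d.
by exists (fun i v w => t (existT _ i (v, w))) => i v w; exact: (tP (existT _ i (v, w))).
Qed.

Variable tau : forall i, V i -> (V i -> k) -> D.
Hypothesis tauP : forall i v w, W w -> (forall x, rho i (tau v w) x = w x *: v) /\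
    forall j, j <> i -> forall x, rho j (tau v w) x = 0.
Arguments tau : clear implicits.

Lemma tauE i v w x : W w -> rho i (tau i v w) x = w x *: v.
Proof. by move=> Ww; have [] := tauP v Ww. Qed.

Lemma tauO i j v w x : W w -> j <> i -> rho j (tau i v w) x = 0.
Proof. by move=> Ww ji; have [_] := tauP v Ww; apply. Qed.

Lemma rho_tau i d v w : W w -> d ** tau i v w = tau i (rho i d v) w.
Proof.
move=> Ww; apply: rho_faithful => j x; rewrite rhoM.
have [ij|ij] := pselect (j = i); last by rewrite !tauO // (semilin0 (@rho_lin j d)).
by case: _ / (esym ij) x => x; rewrite !tauE // (semilinZ (@rho_lin i d)).
Qed.

Lemma dual_rho i (w : V i -> k) d : W w -> W (fun x => w (rho i d x)).
Proof. by move=> Ww; apply: in_MW_dual (rho_MW i d). Qed.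

Lemma tau_rho i d v w : W w -> tau i v w ** d = tau i v (fun x => w (rho i d x)).
Proof.
move=> Ww; have Wd := dual_rho d Ww; apply: rho_faithful => j x; rewrite rhoM.
have [ij|ij] := pselect (j = i); last by rewrite !tauO.
by case: _ / (esym ij) x => x; rewrite !tauE.
Qed.

Lemma tau_tau i v w v' w' : W w -> W w' ->
  tau i v w ** tau i v' w' = w v' *: tau i v w'.
Proof.
move=> Ww Ww'; rewrite rho_tau // tauE //; apply: rho_faithful => j x; rewrite rhoZ.
have [ij|ij] := pselect (j = i); last by rewrite !tauO // scaler0.
by case: _ / (esym ij) x => x; rewrite !tauE // !scalerA mulrC.
Qed.

(** Induction on the support of [d]: the component [e] of [d] at the first index is a sum of
    elements [tau], and [d - e] has smaller support. Scalars are absorbed into [v], so closure under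
    addition suffices. *)
Lemma tau_ind (P : D -> Prop) : P 0 -> (forall x y, P x -> P y -> P (x + y)) ->
  (forall i v w, W w -> P (tau i v w)) -> forall d, P d.
Proof.
move=> P0 PD Ptau d; have [_ [_ [_ [_ [/(_ d)[s ds] _]]]]] := isoD.
elim: s d ds => [|i s IHs] d ds.
  suff -> : d = 0 by []; apply: rho_faithful => i v.
  by rewrite ds // rho0l.
have [e [eE eO] Pe] : exists2 e : D, (forall v, rho i e v = rho i d v) /\
    (forall j, j <> i -> forall v, rho j e v = 0) & P e.
  have [t [tW tE]] := rho_MW i d.
  suff [e [eE eO] Pe] : exists2 e : D,
      (forall v, rho i e v = \sum_(p <- t) T_op p.1 p.2 v) /\
      (forall j, j <> i -> forall v, rho j e v = 0) & P e.
    by exists e => //; split=> // v; rewrite tE eE.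
  elim: t tW {tE} => [|p t IHt] tW.
    by exists 0 => //; split=> [v|j _ v]; rewrite ?big_nil rho0l.
  have [|e [eE eO] Pe] := IHt; first by move=> q qt; apply: tW; right.
  have Wp : W p.2 by apply: tW; left.
  exists (tau i p.1 p.2 + e); last by apply: PD => //; exact: Ptau.
  split=> [v|j ji v]; first by rewrite rhoD big_cons eE tauE.
  by rewrite rhoD eO // tauO // addr0.
rewrite -(subrK e d); apply: PD => //; apply: IHs => j js v.
rewrite rhoD -scaleN1r rhoZ scaleN1r.
have [ij|ij] := pselect (i = j); first by case: _ / ij v => v; rewrite eE subrr.
by rewrite eO ?subr0 => [|ji]; [apply: ds => -[|]|exact/ij/esym].
Qed.

(** Whatever [e] fixes on either side is still fixed by [f], so local units can be built up one
    element at a time. *)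
Definition idem_above (e f : D) : Prop := [/\ f ** f = f, f ** e = e & e ** f = e].

Lemma idem_above_trans e f g : idem_above e f -> idem_above f g -> idem_above e g.
Proof.
move=> [_ fe ef] [gg gf fg]; split=> //.
  by rewrite -fe nua_mulA gf.
by rewrite -ef -nua_mulA fg.
Qed.

Lemma idem_above_refl e : e ** e = e -> idem_above e e.
Proof. by []. Qed.

(* Add to e the rank one idempotent x |-> (w - w e)(x) (v - e v), which is orthogonal to e. *)
Lemma idem_extend i (e : D) v w : e ** e = e -> W w -> w (v - rho i e v) = 1 ->
  exists2 f, idem_above e f & rho i f v = v /\ forall x, w (rho i f x) = w x.
Proof.
move=> ee Ww wv1; have We := dual_rho e Ww.
pose v' := v - rho i e v; pose w' x := w x - w (rho i e x).
have Ww' : W w' by exact: dual_sub.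
have ree j x : rho j e (rho j e x) = rho j e x by rewrite -rhoM ee.
(* The next two facts make $T_{v',w'}$ orthogonal to [e]; then [w' v' = 1] makes it idempotent, and
   [w' v = 1] makes the sum fix [v]. *)
have ev' : rho i e v' = 0 by rewrite (semilinB (@rho_lin i e)) // ree subrr.
have w'e x : w' (rho i e x) = 0 by rewrite /w' ree subrr.
have w'v' : w' v' = 1 by rewrite /w' ev' wv1 (dual0 (sepW i)) // subr0.
have w'v : w' v = 1 by rewrite /w' -(dualB (sepW i)).
have tau0l v1 : tau i v1 (fun x => w' (rho i e x)) = 0.
  have Ww0 := dual_rho e Ww'.
  apply: rho_faithful => j x; rewrite rho0l.
  have [ij|ij] := pselect (j = i); last by rewrite tauO.
  by case: _ / (esym ij) x => x; rewrite tauE // w'e scale0r.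
have tau0r : tau i 0 w' = 0.
  apply: rho_faithful => j x; rewrite rho0l.
  have [ij|ij] := pselect (j = i); last by rewrite tauO.
  by case: _ / (esym ij) x => x; rewrite tauE // scaler0.
exists (e + tau i v' w'); first split.
- rewrite nua_mulDl !nua_mulDr ee rho_tau // ev' tau0r addr0.
  by rewrite tau_rho // tau0l add0r tau_tau // w'v' scale1r.
- by rewrite nua_mulDl ee tau_rho // tau0l addr0.
- by rewrite nua_mulDr ee rho_tau // ev' tau0r addr0.
split=> [|x]; first by rewrite rhoD tauE // w'v scale1r addrC subrK.
rewrite rhoD tauE // addrC (dual_lin (sepW i)) // wv1 mulr1.
by rewrite /w' subrK.
Qed.

Lemma idem_fix_vector i (e : D) v : e ** e = e ->
  exists2 f, idem_above e f & rho i f v = v.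
Proof.
move=> ee; have [ev|ev] := pselect (v - rho i e v = 0).
  by exists e; [exact: idem_above_refl|apply/esym/eqP; rewrite -subr_eq0 ev].
have [w Ww wv] := dual_separate (sepW i) ev.
by have [f ef [fv _]] := idem_extend ee Ww wv; exists f.
Qed.

Lemma idem_fix_dual i (e : D) w : e ** e = e -> W w ->
  exists2 f, idem_above e f & forall x, w (rho i f x) = w x.
Proof.
move=> ee Ww; have [we|/existsNP[x /eqP wx]] := pselect (forall x, w (x - rho i e x) = 0).
  exists e; first exact: idem_above_refl.
  by move=> x; apply/esym/eqP; rewrite -subr_eq0 -(dualB (sepW i)) // we.
(* Rescaling [x] by [c] achieves the normalisation required by [idem_extend]. *)
pose c := (w (x - rho i e x))^-1.
have [|f ef [_ fw]] := @idem_extend i e (c *: x) w ee Ww; last by exists f.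
rewrite (semilinZ (@rho_lin i e)) // -scalerBr (dualZ (sepW i)) //.
by rewrite mulVf.
Qed.

(** The statement is for all [e], so that in a sum the unit for the second term can be taken above
    the unit for the first. For [tau i v w], fixing [v] handles left multiplication and fixing [w]
    handles right multiplication. *)
Lemma idem_unit (x e : D) : e ** e = e ->
  exists2 f, idem_above e f & f ** x = x /\ x ** f = x.
Proof.
elim/tau_ind: x e.
- move=> e ee; exists e; first exact: idem_above_refl.
  by rewrite nua_mul0 nua_mulr0.
- move=> x y IHx IHy e /IHx[f ef [fx xf]].
  have [g fg [gy yg]] : exists2 g, idem_above f g & g ** y = y /\ y ** g = y.
    by apply: IHy; case: ef.
  exists g; first exact: idem_above_trans fg.
  have [_ gf fg'] := fg.
  by rewrite nua_mulDl nua_mulDr gy yg -fx nua_mulA gf fx -xf -nua_mulA fg' xf.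
- move=> i v w Ww e ee.
  have [f ef fv] := idem_fix_vector v ee.
  have [g fg gw] : exists2 g, idem_above f g & forall x, w (rho i g x) = w x.
    by apply: idem_fix_dual => //; case: ef.
  exists g; first exact: idem_above_trans fg.
  rewrite rho_tau // tau_rho //; split; last by congr tau; apply/funext.
  by rewrite -fv -rhoM; case: fg => _ -> _.
Qed.

Lemma dsum_local_units : has_local_units D.
Proof.
elim=> [|x xs [e [ee exs]]].
  by exists 0; split=> //; rewrite nua_mul0.
have [f [ff fe ef] [fx xf]] := idem_unit x ee.
exists f; split=> // y [<-//|/exs[ey ye]]; split.
  by rewrite -ey nua_mulA fe.
by rewrite -ye -nua_mulA ef.
Qed.

Lemma idem_fix_list i (vs : seq (V i)) :
  exists2 e : D, e ** e = e & forall v, v \in vs -> rho i e v = v.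
Proof.
elim: vs => [|v vs [e ee evs]].
  by exists 0 => //; rewrite nua_mul0.
have [f [ff fe ef] fv] := idem_fix_vector v ee.
exists f => // u; rewrite inE => /predU1P[->//|/evs eu].
by rewrite -eu -rhoM fe.
Qed.

Definition std_mod i : numod D :=
  @NUMod k D (V i) (rho i) (@rhoD i)
    (fun d => semilinD (@rho_lin i d) erefl) (@rhoZ i)
    (fun a d => semilinZ (@rho_lin i d) erefl a) (@rhoM i).

Lemma std_mod_abs_simple i : (exists v : V i, v <> 0) -> abs_simple (std_mod i).
Proof.
move=> [v0 /(dual_separate (sepW i))[w0 Ww0 wv0]] K iota T j Tj r rlin rj.
have jlin : restr_linear iota j by have [] := Tj.
have [w0K w0Klin w0Kj] := @scalar_ext_lift _ _ iota _ _ _ Tj K^o (fun v => iota (w0 v))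
  (fun a x y => etrans (congr1 iota (dual_lin (sepW i) Ww0 a x y))
     (etrans (rmorphD iota _ _) (congr1 (+%R^~ _) (rmorphM iota _ _)))).
have jv0 : j v0 <> 0.
  move=> jv; have := w0Kj v0; rewrite jv (semilin0 w0Klin) // wv0 rmorph1.
  by move/eqP; rewrite eq_sym oner_eq0.
split.
  exists (tau i v0 w0), (j v0); rewrite rj /= tauE // wv0 scale1r.
  exact: jv0.
move=> S S0 SD SZ Sr; have [|nS] := pselect (forall x, S x -> x = 0); first by left.
right; have /existsNP[t /not_implyP[St t0]] := nS.
(* [r d] is only prescribed on the image of [j]; additivity in [d] follows from uniqueness of
   extensions. *)
have rD d e x : r (d + e) x = r d x + r e x.
  move: x; apply: (scalar_ext_uniq Tj (rlin _)) => [a x y|m].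
    by rewrite !rlin scalerDr addrACA.
  by rewrite !rj /= rhoD (semilinD jlin) ?rmorph1.
have r0 x : r 0 x = 0.
  by apply: (addrI (r 0 x)); rewrite -rD !addr0.
have [e _ et] : exists2 e : D, True & r e t = t.
  have [s tE] := scalar_ext_span Tj t.
  have [e _ es] := idem_fix_list [seq p.2 | p <- s].
  exists e => //; rewrite tE (semilin_sum (rlin e)) //; apply: eq_big_seq => p ps.
  by rewrite (semilinZ (rlin e)) // rj /= es // map_f.
have [u [w [Ww rt]]] : exists u w, W w /\ r (tau i u w) t <> 0.
  apply: contrapT => nr; apply: t0; rewrite -et; elim/tau_ind: e {et} => //.
    by move=> d e hd he; rewrite rD hd he addr0.
  move=> i' u w Ww; have [ii'|ii'] := pselect (i = i').
    move: u w Ww; case: _ / ii' => u w Ww.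
    by apply: contrapT => h; apply: nr; exists u, w.
  move: t {St nr}; apply: (scalar_ext_uniq Tj (rlin _)) => [a x y|m].
    by rewrite scaler0 addr0.
  by rewrite rj /= tauO // (semilin0 jlin) // rmorph1.
have [wK wKlin wKj] := @scalar_ext_lift _ _ iota _ _ _ Tj K^o (fun v => iota (w v))
  (fun a x y => etrans (congr1 iota (dual_lin (sepW i) Ww a x y))
     (etrans (rmorphD iota _ _) (congr1 (+%R^~ _) (rmorphM iota _ _)))).
(* With [w] kept and [u'] varied, [S] acquires every [j u'], because [wK t] is invertible. *)
have rtau u' x : r (tau i u' w) x = wK x *: j u'.
  move: x; apply: (scalar_ext_uniq Tj (rlin _)) => [a x y|m].
    by rewrite wKlin scalerDl scalerA.
  by rewrite rj /= tauE // (semilinZ jlin) ?rmorph1 // wKj.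
have wt : wK t != 0 by apply/eqP => wt; apply: rt; rewrite rtau wt scale0r.
have Sj u' : S (j u').
  have := SZ (wK t)^-1 _ (Sr (tau i u' w) _ St).
  by rewrite rtau scalerA mulVf // scale1r.
move=> x; have [s ->] := scalar_ext_span Tj x.
by elim/big_ind: _ => // p _; exact: SZ.
Qed.

(** The pair defines the rank one idempotent $e_i$; a zero space gets the pair of zeros. *)
Lemma std_frame i : exists p : V i * (V i -> k),
  W p.2 /\ ((exists v : V i, v <> 0) -> p.2 p.1 = 1).
Proof.
have [[v v0]|V0] := pselect (exists v : V i, v <> 0).
  by have [w Ww wv] := dual_separate (sepW i) v0; exists (v, w).
by exists (0, fun=> 0); split=> //=; have [_ []] := sepW i.
Qed.

Lemma tau_lin i w a u v : W w ->
  tau i (a *: u + v) w = a *: tau i u w + tau i v w.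
Proof.
move=> Ww; apply: rho_faithful => j x; rewrite rhoD rhoZ.
have [ij|ij] := pselect (j = i); last by rewrite !tauO // scaler0 addr0.
by case: _ / (esym ij) x => x; rewrite !tauE // scalerDr !scalerA mulrC.
Qed.

Lemma tau0 i w : W w -> tau i 0 w = 0.
Proof. by move=> Ww; apply: (semilin0 (fun a u v => tau_lin a u v Ww)). Qed.

Lemma dsum_abs_semisimple : abs_semisimple_alg D.
Proof.
move=> M unitM.
pose v0 i := (sval (cid (std_frame i))).1.
pose w0 i := (sval (cid (std_frame i))).2.
have Ww0 i : W (w0 i) by rewrite /w0; case: cid => ? [].
have wv0 i : (exists v : V i, v <> 0) -> w0 i (v0 i) = 1.
  by rewrite /w0 /v0; case: cid => ? [].
have V0_tau i v w : W w -> ~ (exists v : V i, v <> 0) -> tau i v w = 0.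
  move=> Ww V0; rewrite -(@tau0 i w Ww); congr tau.
  by apply: contrapT => vn; apply: V0; exists v.
(* The space $e_iM$, described as the fixed points of $e_i$. *)
pose P i (m : M) := num_act (tau i (v0 i) (w0 i)) m = m.
have subP i : subspace (P i).
  split; first exact: num_act0.
  by move=> a x y Px Py; rewrite /P num_act_lin Px Py.
pose B i := sval (cid (subspace_basis (subP i))).
have BP i b : B i b -> P i b.
  by rewrite /B; case: cid => /= B' [B'P _]; exact: B'P.
have Bindep i s : (forall b, b \in s -> B i b) -> lin_indep s.
  by rewrite /B; case: cid => /= B' [_ [B'P _]]; exact: B'P.
have Bspan i x : P i x -> exists s : seq (k * M),
    (forall p, p \in s -> B i p.2) /\ x = \sum_(p <- s) p.1 *: p.2.
  by rewrite /B; case: cid => /= B' [_ [_ B'P]]; exact: B'P.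
pose J := {i : I & {b : M | B i b}}.
pose N (j : J) := std_mod (projT1 j).
pose inj (j : J) (v : N j) : M :=
  num_act (tau (projT1 j) v (w0 (projT1 j))) (sval (projT2 j)).
have inj_lin j a x y : inj j (a *: x + y) = a *: inj j x + inj j y.
  by rewrite /inj tau_lin // num_actlin.
exists J, N, inj; split.
  (* If $V_i$ were zero, then $e_i=0$ and the basis vector $b=e_ib$ would vanish. *)
  move=> [i [b Bb]]; apply: std_mod_abs_simple; apply: contrapT => V0.
  have b0 : b = 0.
    by rewrite -(BP i b Bb) V0_tau // num_act0l.
  have indb : lin_indep [:: b].
    by apply: (Bindep i) => x; rewrite inE => /eqP->.
  have /eqP : (1 : k) = 0.
    apply: (indb (fun=> 1) _ b (mem_head _ _)).
    by rewrite big_seq1 b0 scaler0.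
  by rewrite oner_eq0.
split.
  move=> j; split; first exact: inj_lin.
  by move=> d v; rewrite /inj /= -rho_tau // num_actA.
split.
  move=> s sU s0 p0 p0s; apply: contrapT => v_neq0.
  pose idx (p : {j : J & N j}) : I := projT1 (projT1 p).
  pose bas (p : {j : J & N j}) : M := sval (projT2 (projT1 p)).
  pose i := idx p0.
  have [w Ww wv] := dual_separate (sepW i) v_neq0.
  (* Since $T_{v_0,w}T_{v,w_0}b=w(v)b$, and terms at other indices are killed, [d] turns the given
     relation into one among basis vectors of $e_iM$, with coefficient 1 at the vector of [p0]. *)
  pose d := tau i (v0 i) w.
  (* At index [i] this is the value of [w] on the vector of [p]; the detour through [rho] makes
     sense at every index and avoids a transport. *)
  pose coef (p : {j : J & N j}) : k := w0 (idx p) (rho (idx p) d (projT2 p)).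
  have Bbas p : B (idx p) (bas p) by rewrite /bas; case: (projT2 (projT1 p)).
  have wvi : w0 i (v0 i) = 1 by apply: wv0; exists (projT2 p0).
  have actI p : idx p = i -> num_act d (inj _ (projT2 p)) = coef p *: bas p.
    have Pb := BP _ _ (Bbas p).
    rewrite /coef /inj; move: Pb; rewrite /bas /idx; move: (projT2 p).
    rewrite /N /=; case: (projT1 p) => /= i' [b Bb] /= v Pb ii'.
    move: b v Bb Pb; rewrite ii' => b v Bb Pb.
    rewrite -num_actA tau_tau // num_actZl Pb tauE // (dualZ (sepW i)) //.
    by rewrite wvi mulr1.
  have actO p : idx p <> i -> num_act d (inj _ (projT2 p)) = 0.
    by move=> pi; rewrite /inj -num_actA rho_tau // tauO // tau0 // num_act0l.
  have idx_bas p q : idx p = i -> idx q = i -> bas p = bas q -> projT1 p = projT1 q.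
    rewrite /idx /bas; case: (projT1 p) (projT1 q) => [i1 [b1 h1]] [i2 [b2 h2]] /=.
    move=> e1 e2; move: h1 h2; rewrite e1 e2 => h1 h2 b12.
    by congr existT; exact: eq_exist.
  (* The summands have distinct indices in [J], so those over [i] have distinct basis vectors, and
     their coefficients define a function of the vector. *)
  have [c [bs [ubs [bsP [sumE cP]]]]] : exists (c : M -> k) (bs : seq M),
      uniq bs /\ (forall b, b \in bs -> exists p, [/\ List.In p s, idx p = i & bas p = b]) /\
      \sum_(p <- s) num_act d (inj _ (projT2 p)) = \sum_(b <- bs) c b *: b /\
      (forall p, List.In p s -> idx p = i -> bas p \in bs /\ c (bas p) = coef p).
    elim: s sU {s0 p0s} => [_|p s IHs /= sU].
      by exists (fun=> 0), [::]; rewrite !big_nil.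
    have [pnew sU'] : ~ List.In (projT1 p) (List.map (@projT1 _ _) s) /\
        List.NoDup (List.map (@projT1 _ _) s) by inversion sU.
    have [c [bs [ubs [bsP [sumE cP]]]]] := IHs sU'.
    have [pi|pi] := pselect (idx p = i); last first.
      exists c, bs; split=> //; split.
        by move=> b /bsP[q [qs qi qb]]; exists q; split=> //; right.
      split; first by rewrite big_cons actO // add0r.
      by move=> q [<-//|]; exact: cP.
    have pbs : bas p \notin bs.
      apply/negP => /bsP[q [qs qi qb]]; apply: pnew.
      by rewrite -(idx_bas q p) //; apply: List.in_map.
    exists (fun b => if b == bas p then coef p else c b), (bas p :: bs).
    split; first by rewrite /= pbs.
    split.
      move=> b; rewrite inE => /predU1P[->|/bsP[q [qs qi qb]]].
        by exists p; split=> //; left.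
      by exists q; split=> //; right.
    split.
      rewrite !big_cons eqxx actI // sumE; congr (_ + _).
      apply: eq_big_seq => b bbs; case: eqP => // bE.
      by rewrite -bE bbs in pbs.
    move=> q [<-|qs] qi; first by rewrite mem_head eqxx.
    have [qbs cq] := cP q qs qi; rewrite inE qbs orbT; split=> //.
    case: eqP => // qp; by rewrite -qp qbs in pbs.
  have [p0bs cp0] := cP p0 p0s erefl.
  have : c (bas p0) = 0.
    have /(_ c) : lin_indep bs.
      by apply: (Bindep i) => b /bsP[p [_ <- <-]].
    apply=> //; rewrite undup_id // -sumE -(semilin_sum (@num_act_lin _ _ M d)) //.
    by rewrite s0 num_act0.
  rewrite cp0 /coef tauE // (dualZ (sepW i)) // wvi mulr1 wv => /eqP.
  by rewrite oner_eq0.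
pose Q m := exists s : seq {j : J & N j}, m = \sum_(p <- s) inj (projT1 p) (projT2 p).
have Q0 : Q 0 by exists [::]; rewrite big_nil.
have QD x y : Q x -> Q y -> Q (x + y).
  by move=> [s ->] [t ->]; exists (s ++ t); rewrite big_cat.
move=> m; have [s ->] := unitM m; apply: (big_ind Q) => // -[d x] _ /=.
elim/tau_ind: d => [||i v w Ww].
- by rewrite num_act0l.
- by move=> d e Qd Qe; rewrite num_actDl; exact: QD.
have [Vn|V0] := pselect (exists v : V i, v <> 0); last by rewrite V0_tau // num_act0l.
(* The right factor carries [x] into $e_iM$, where it is expanded in the basis; the left factor
   sends each basis vector [b] to [inj] of [v] at [b]. *)
have -> : tau i v w = tau i v (w0 i) ** tau i (v0 i) w.
  by rewrite tau_tau // wv0 // scale1r.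
rewrite num_actA; have Px : P i (num_act (tau i (v0 i) w) x).
  by rewrite /P -num_actA tau_tau // wv0 // scale1r.
have [t [tB ->]] := Bspan i _ Px.
rewrite (semilin_sum (@num_act_lin _ _ M _)) //; elim: t tB => [|p t IHt] tB.
  by rewrite big_nil.
rewrite big_cons; apply: QD; last by apply: IHt => q qt; apply: tB; rewrite inE qt orbT.
have Bp := tB p (mem_head _ _).
pose j : J := existT _ i (exist _ _ Bp).
exists [:: existT N j (p.1 *: v)]; rewrite big_seq1 /=.
have -> : p.1 *: v = p.1 *: (v : N j) + 0 by rewrite addr0.
rewrite inj_lin num_actZr /inj /=.
by rewrite tau0 // num_act0l addr0.
Qed.

End DirectSumAlgebra.

(** Part (1) is proved for every algebra carrying the isomorphism, and the explicit [dsum_alg] shows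
    that such an algebra exists. *)
Theorem mainTheorem2 (k : fieldType) :
  (forall (I : Type) (V : I -> lmodType k) (W : forall i, (V i -> k) -> Prop),
     (forall i, separating_dual_subspace (W i)) ->
     (exists (D : nualg k) (rho : forall i, D -> V i -> V i), @dsum_MW_iso k D I V W rho) /\
     (forall (D : nualg k) (rho : forall i, D -> V i -> V i),
        @dsum_MW_iso k D I V W rho -> has_local_units D /\ abs_semisimple_alg D))
  /\
  (forall D : nualg k, has_local_units D -> abs_semisimple_alg D ->
     exists (I : Type) (V : I -> lmodType k) (W : forall i, (V i -> k) -> Prop)
            (rho : forall i, D -> V i -> V i),
       (forall i, separating_dual_subspace (W i)) /\ @dsum_MW_iso k D I V W rho).
Proof.
split=> [I V W sepW|D]; last exact: abs_semisimple_classification.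
split=> [|D rho isoD].
  by exists (dsum_alg sepW); eexists; exact: dsum_alg_iso.
have [tau tauP] := exists_tau isoD.
split; first exact: (dsum_local_units sepW isoD tauP).
exact: (dsum_abs_semisimple sepW isoD tauP).
Qed.
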